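(* If there exists at least one sufficient contour subspace with structural dimension $d_0<\{p+\dim(\mathcal{K}_{y|\vec{x}})\}/2$, then the generalized contour subspace (GCS) of $Y|\vec{X}$ is unique. In addition, if the central contour subspace $\mathcal{C}_{y|\vec{x}}$ exists, then $\mathcal{G}_{y|\vec{x}}=\mathcal{C}_{y|\vec{x}}$ and $\mathcal{G}_{y|\vec{x}}$ is unique.
   Context: Let $p>1$, let $Y$ be a real random variable and let $X$ be a random vector in $\mathbb{R}^p$ with an elliptically symmetric distribution, standardized to have location $0$ and scatter matrix $I_p$; i.e. $X$ has a Lebesgue density of the form $x\mapsto f(\|x\|^2)$, with $\|\cdot\|$ the Euclidean norm. Put $\vec{X}=X/\|X\|$. For a matrix $H$, $\mathcal{S}(H)$ is its column space; the zero-dimensional subspace is allowed. Sufficient contour subspace (SCS): a subspace $\mathcal{S}(B)$, $B\in\mathbb{R}^{p\times d}$, such that $Y$ is conditionally independent of $\vec{X}$ given $B^\top\vec{X}$; its structural dimension is $\dim\mathcal{S}(B)$. Kernel contour subspace: $\mathcal{K}_{y|\vec{x}}$ is the intersection of all SCSs. If $\mathcal{K}_{y|\vec{x}}$ is itself an SCS, it is called the central contour subspace (CCS), denoted $\mathcal{C}_{y|\vec{x}}$; otherwise the CCS does not exist. A generalized contour subspace (GCS), denoted $\mathcal{G}_{y|\vec{x}}$, is an SCS having the smallest dimension among all SCSs; this smallest dimension is denoted $d_0$. At least one GCS always exists. *)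

(* Defs.v *)
From HB Require Import structures.
From mathcomp Require Import all_boot all_order all_algebra.
From mathcomp Require Import all_classical all_reals all_analysis.

Set Implicit Arguments.
Unset Strict Implicit.
Unset Printing Implicit Defensive.
Import Order.TTheory GRing.Theory Num.Theory.
Import numFieldNormedType.Exports.

Local Open Scope classical_set_scope.
Local Open Scope ring_scope.

Definition measure_mx_display : measure_display -> measure_display.
Proof. exact. Qed.

(* The product sigma-algebra on matrices; on 'cV[R]_n it is the Borel
   sigma-algebra of R^n. *)
Section measurable_mx.
Context {d} {T : measurableType d} (m n : nat).

Definition mx_sigma_algebra : set (set 'M[T]_(m, n)) :=
  <<s \bigcup_(ij in [set: 'I_m * 'I_n])
        preimage_set_system setT (fun M : 'M[T]_(m, n) => M ij.1 ij.2)
          measurable >>.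

Let mx_set0 : mx_sigma_algebra set0.
Proof. exact: sigma_algebra0. Qed.

Let mx_setC A : mx_sigma_algebra A -> mx_sigma_algebra (~` A).
Proof. exact: sigma_algebraC. Qed.

Let mx_bigcup (F : (set 'M[T]_(m, n))^nat) :
  (forall i, mx_sigma_algebra (F i)) -> mx_sigma_algebra (\bigcup_i (F i)).
Proof. exact: sigma_algebra_bigcup. Qed.

HB.instance Definition _ := @isMeasurable.Build (measure_mx_display d)
  'M[T]_(m, n) mx_sigma_algebra mx_set0 mx_setC mx_bigcup.

Lemma measurable_coord i j :
  measurable_fun [set: 'M[T]_(m, n)] (fun M : 'M[T]_(m, n) => M i j).
Proof.
move=> _ B mB; rewrite setTI; apply: sub_sigma_algebra.
by exists (i, j) => //; exists B => //; rewrite setTI.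
Qed.

Lemma measurable_fun_mxP d' (S : measurableType d') (f : S -> 'M[T]_(m, n)) :
  measurable_fun setT f <-> forall i j, measurable_fun setT (fun s => f s i j).
Proof.
split=> [mf i j|mf].
  exact: (measurableT_comp (measurable_coord i j) mf).
apply: (@measurability _ _ _ _ setT f _ erefl).
move=> _ [A [[i j] _ [B mB <-]] <-].
rewrite !setTI -comp_preimage -[X in measurable X]setTI.
exact: (mf i j).
Qed.

End measurable_mx.

Lemma sigma_finite_product d1 d2 (T1 : measurableType d1)
    (T2 : measurableType d2) (R : realType)
    (m1 : {sigma_finite_measure set T1 -> \bar R})
    (m2 : {sigma_finite_measure set T2 -> \bar R}) :
  sigma_finite setT (product_measure1 m1 m2).
Proof.
have /sigma_finiteP[F [TF ndF Foo]] := sigma_finiteT m1.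
have /sigma_finiteP[G [TG ndG Goo]] := sigma_finiteT m2.
exists (fun n => F n `*` G n).
  rewrite -setXTT TF TG predeqE => -[x y]; split.
    move=> [/= [n _ Fnx] [k _ Gky]]; exists (maxn n k) => //; split.
    - by move: x Fnx; exact/subsetPset/ndF/leq_maxl.
    - by move: y Gky; exact/subsetPset/ndG/leq_maxr.
  by move=> [n _ []/= ? ?]; split; exists n.
move=> k; have [mF oF] := Foo k; have [mG oG] := Goo k.
split; first exact: measurableX.
by rewrite product_measure1E// lte_mul_pinfty// ge0_fin_numE.
Qed.

Section lebesgue_cV.
Context {R : realType}.

Definition cV_cons n (xv : R * 'cV[R]_n) : 'cV[R]_n.+1 :=
  col_mx (xv.1%:M : 'cV[R]_1) xv.2.

Lemma cV_cons0 n (xv : R * 'cV[R]_n) : cV_cons xv ord0 0 = xv.1.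
Proof.
have -> : ord0 = lshift n (ord0 : 'I_1) :> 'I_(1 + n) by exact/val_inj.
by rewrite [LHS]col_mxEu mxE eqxx mulr1n.
Qed.

Lemma cV_consS n (xv : R * 'cV[R]_n) i : cV_cons xv (lift ord0 i) 0 = xv.2 i 0.
Proof.
have -> : lift ord0 i = rshift 1 i :> 'I_(1 + n) by exact/val_inj.
exact: col_mxEd.
Qed.

Lemma measurable_cV_cons n :
  measurable_fun [set: R * 'cV[R]_n] (@cV_cons n).
Proof.
apply/measurable_fun_mxP => i j; rewrite ord1 {j}.
have [j ->|->] := unliftP ord0 i.
  under eq_fun do rewrite cV_consS.
  exact: (measurableT_comp (measurable_coord j 0) measurable_snd).
by under eq_fun do rewrite cV_cons0; exact: measurable_fst.
Qed.

Definition cV_uncons n (v : 'cV[R]_n.+1) : R * 'cV[R]_n :=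
  (v ord0 0, \col_i v (lift ord0 i) 0).

Lemma cV_consK n : cancel (@cV_cons n) (@cV_uncons n).
Proof.
move=> [x v]; congr pair; first exact: cV_cons0.
by apply/colP => i; rewrite mxE cV_consS.
Qed.

Lemma cV_unconsK n : cancel (@cV_uncons n) (@cV_cons n).
Proof.
move=> v; apply/colP => i.
by have [j ->|->] := unliftP ord0 i; rewrite (cV_consS, cV_cons0)/= ?mxE.
Qed.

Lemma measurable_cV_uncons n :
  measurable_fun [set: 'cV[R]_n.+1] (@cV_uncons n).
Proof.
apply/measurable_fun_pair; first exact: measurable_coord.
apply/measurable_fun_mxP => i j; under eq_fun do rewrite mxE.
exact: measurable_coord.
Qed.

Section step.
Context n (mu : {sigma_finite_measure set 'cV[R]_n -> \bar R}).

Definition lebesgue_cVS : set 'cV[R]_n.+1 -> \bar R :=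
  pushforward (product_measure1 (@lebesgue_measure R) mu) (@cV_cons n).

Let mcons : measurable_fun [set: R * 'cV[R]_n] (@cV_cons n).
Proof. exact: measurable_cV_cons. Qed.

Let lebesgue_cVS0 : lebesgue_cVS set0 = 0%E.
Proof. exact: measure0. Qed.

Let lebesgue_cVS_ge0 A : (0 <= lebesgue_cVS A)%E.
Proof. exact: measure_ge0. Qed.

Let lebesgue_cVS_sigma_additive : semi_sigma_additive lebesgue_cVS.
Proof. exact: measure_semi_sigma_additive. Qed.

HB.instance Definition _ := isMeasure.Build _ _ _ lebesgue_cVS
  lebesgue_cVS0 lebesgue_cVS_ge0 lebesgue_cVS_sigma_additive.

Let lebesgue_cVS_sigma_finite : sigma_finite setT lebesgue_cVS.
Proof.
have [F FT Foo] := sigma_finite_product (@lebesgue_measure R) mu.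
exists (fun k => @cV_uncons n @^-1` F k).
  by rewrite -preimage_bigcup -FT preimage_setT.
move=> k; have [mF oo] := Foo k; split.
  by rewrite -[X in measurable X]setTI; exact: measurable_cV_uncons.
rewrite /lebesgue_cVS /pushforward -comp_preimage.
by rewrite (_ : _ \o _ = id) //; apply/funext => x /=; rewrite cV_consK.
Qed.

HB.instance Definition _ := Measure_isSigmaFinite.Build _ _ _ lebesgue_cVS
  lebesgue_cVS_sigma_finite.

End step.

(* n-fold product of the Lebesgue measure on R, built along the bijection
   R * R^n -> R^(n+1); lebesgue_cV_box gives its value on boxes. *)
Fixpoint lebesgue_cV n : {sigma_finite_measure set 'cV[R]_n -> \bar R} :=
  match n with
  | 0 => @dirac _ 'cV[R]_0 0 R
  | n'.+1 => lebesgue_cVS (lebesgue_cV n')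
  end.

Lemma lebesgue_cV_box n (A : 'I_n -> set R) : (forall i, measurable (A i)) ->
  lebesgue_cV n [set v | forall i, A i (v i 0)] =
  (\prod_(i < n) lebesgue_measure (A i))%E.
Proof.
elim: n A => [|n IH] A mA.
  by rewrite big_ord0 /= diracE mem_set// => -[].
rewrite big_ord_recl -IH// /= /lebesgue_cVS /pushforward.
pose B := [set v : 'cV[R]_n | forall i, A (lift ord0 i) (v i 0)].
rewrite (_ : _ @^-1` _ = A ord0 `*` B); last first.
  apply/seteqP; split=> -[x v] /=.
    move=> h; split; first by have := h ord0; rewrite cV_cons0.
    by move=> i; have := h (lift ord0 i); rewrite cV_consS.
  move=> [Ax Bv] i; have [j ->|->] := unliftP ord0 i.
    by rewrite cV_consS; exact: Bv.
  by rewrite cV_cons0.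
have mB : measurable B.
  have -> : B = \bigcap_(i in [set: 'I_n])
      (fun v : 'cV[R]_n => v i 0) @^-1` A (lift ord0 i).
    by apply/seteqP; split=> [v h i _|v h i]; [exact: h|exact: (h i I)].
  apply: fin_bigcap_measurable => // i _.
  by rewrite -[X in measurable X]setTI; exact: measurable_coord.
by rewrite product_measure1E//; exact: mA.
Qed.

End lebesgue_cV.

(* Euclidean norm; the library norm of 'cV[R]_n is the sup norm. *)
Definition enorm {R : realType} {n : nat} (v : 'cV[R]_n) : R :=
  Num.sqrt (\sum_i v i 0 ^+ 2).

Section random_vectors.
Context {R : realType} d (T : measurableType d) (P : probability T R).

Definition has_lebesgue_density p (X : {RV P >-> 'cV[R]_p}) (g : 'cV[R]_p -> R) :=
  [/\ measurable_fun setT g, forall x, 0 <= g x &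
      forall A, measurable A ->
        distribution P X A = (\int[lebesgue_cV p]_(x in A) (g x)%:E)%E].

(* g is a version of P(E | V) *)
Definition cond_prob d1 (T1 : measurableType d1) (V : T -> T1) (E : set T)
    (g : T -> R) :=
  [/\ @measurable_fun _ _ (g_sigma_algebra_preimageType V) R setT g,
      P.-integrable setT (EFin \o g) &
      forall D, g_sigma_algebra_preimage V D ->
        (\int[P]_(w in D) (g w)%:E)%E = P (E `&` D)].

(* U1 and U2 are conditionally independent given V; the existence of versions
   of the conditional probabilities is no restriction (Radon-Nikodym). *)
Definition cond_indep d1 d2 d3 (T1 : measurableType d1) (T2 : measurableType d2)
    (T3 : measurableType d3) (U1 : T -> T1) (U2 : T -> T2) (V : T -> T3) :=
  forall A1 A2, measurable A1 -> measurable A2 ->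
  exists g1 g2 g12 : T -> R,
  [/\ cond_prob V (U1 @^-1` A1) g1,
      cond_prob V (U2 @^-1` A2) g2,
      cond_prob V (U1 @^-1` A1 `&` U2 @^-1` A2) g12 &
      {ae P, forall w, g12 w = g1 w * g2 w}].

End random_vectors.

Section vspace_bigcap.
Context {K : fieldType} {V : vectType K}.

Lemma vspace_bigcap_ex (F : set {vspace V}) :
  exists U : {vspace V}, forall v, v \in U <-> forall W, F W -> v \in W.
Proof.
pose below (U : {vspace V}) := forall W, F W -> (U <= W)%VS.
have [U bU maxU] : exists2 U, below U & forall U', below U' -> (\dim U' <= \dim U)%N.
  pose Q k := `[< exists2 U, below U & \dim U = k >].
  have exQ : exists k, Q k.
    by exists 0%N; apply/asboolP; exists 0%VS; rewrite ?dimv0// => W _; exact: sub0v.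
  have ubQ k : Q k -> (k <= \dim {:V})%N.
    by move=> /asboolP[U _ <-]; rewrite dimvS// subvf.
  case: (ex_maxnP exQ ubQ) => k /asboolP[U bU Uk] kmax.
  by exists U => // U' bU'; rewrite Uk kmax//; apply/asboolP; exists U'.
exists U => v; split=> [vU W FW|h]; first exact: (subvP (bU _ FW)).
have b' : below (U + <[v]>)%VS.
  by move=> W FW; rewrite subv_add bU//= -memvE h.
have /eqP -> : U == (U + <[v]>)%VS by rewrite eqEdim addvSl maxU.
by rewrite (subvP (addvSr _ _))// memv_line.
Qed.

Definition vspace_bigcap (F : set {vspace V}) : {vspace V} :=
  sval (cid (vspace_bigcap_ex F)).

Lemma vspace_bigcapP (F : set {vspace V}) v :
  v \in vspace_bigcap F <-> forall W, F W -> v \in W.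
Proof. by rewrite /vspace_bigcap; case: cid => U /= ->. Qed.

End vspace_bigcap.

Definition colspace {R : realType} p k (B : 'M[R]_(p, k)) : {vspace 'cV[R]_p} :=
  <<[seq col j B | j <- enum 'I_k]>>%VS.

Section contour_subspaces.
Context {R : realType} d (T : measurableType d) (P : probability T R).
Context p (Y : {RV P >-> R}) (X : {RV P >-> 'cV[R]_p}).

(* Takes the value 0 on {X = 0}, a null event when X has a density. *)
Definition direction (w : T) : 'cV[R]_p := (enorm (X w))^-1 *: X w.

Definition is_SCS (S : {vspace 'cV[R]_p}) :=
  exists k (B : 'M[R]_(p, k)),
    S = colspace B /\
    cond_indep P Y direction (fun w => B^T *m direction w).

Definition kernel_contour_subspace : {vspace 'cV[R]_p} :=
  vspace_bigcap is_SCS.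

Definition is_CCS (C : {vspace 'cV[R]_p}) :=
  C = kernel_contour_subspace /\ is_SCS C.

Definition is_min_SCS_dim (k : nat) :=
  (exists S, is_SCS S /\ \dim S = k) /\ forall S, is_SCS S -> (k <= \dim S)%N.

Definition is_GCS (G : {vspace 'cV[R]_p}) :=
  is_SCS G /\ is_min_SCS_dim (\dim G).

End contour_subspaces.

(* Main.v *)
From HB Require Import structures.
Require Import Defs.
From mathcomp Require Import all_boot all_order all_algebra.
From mathcomp Require Import all_classical all_reals all_analysis.
From mathcomp Require Import measurable_realfun zify ring.
Import Order.TTheory GRing.Theory Num.Theory.
Import numFieldNormedType.Exports.
Local Open Scope classical_set_scope.
Local Open Scope ring_scope.

(** The second claim is linear algebra: the central subspace is contained in all
sufficient ones and is one of them. The first claim follows from [is_SCS_cap]: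
the intersection of two sufficient subspaces whose sum is proper is sufficient.
Two generalized subspaces of dimension [d0] contain the kernel, so their sum has
dimension at most [2 d0 - dim K < p]; their intersection is then sufficient, and
both are equal to it by minimality.

A subspace is sufficient when, for every event [E] of [Y], the conditional
probability of [E] given the direction is a function of the projection of the
direction ([cond_indepP]). Two sufficient subspaces thus give two functions [h1]
and [h2], of two projections, equal for almost every direction, and a function
of the projection on the intersection has to be found. In the space, functions
of two projections which agree almost everywhere on a convex open set are
invariant, up to null sets, by small translations along the orthogonal
complements of both subspaces, hence along the complement of the intersection,
and the result follows from Fubini ([factor_through_intersection]). The sphere
is not the space, but the sum of the subspaces is orthogonal to some unit vector
[e]. The hyperplane orthogonal to [e] carries all the projections, and the
projection of a uniform direction on it has the same null sets as the Lebesgue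
measure of the unit ball. This is where a proper sum is needed, and it is stated
with the cylinder over this ball, to avoid choosing coordinates ([null_cone],
[null_cone_cylinder]).

Only null sets matter in this comparison: null sets of [R] and of [R^n] are
preserved by translations, and a Fubini argument extends this to dilations, to
squaring and to square roots ([null_preimage_hom]). *)

Set Implicit Arguments.
Unset Strict Implicit.
Unset Printing Implicit Defensive.

(** * Null sets of product measures *)

Lemma measurable_preimageT d1 d2 (T1 : measurableType d1)
    (T2 : measurableType d2) (F : T1 -> T2) (A : set T2) :
  measurable_fun setT F -> measurable A -> measurable [set x | A (F x)].
Proof. by move=> mF mA; rewrite -[X in measurable X]setTI; exact: mF. Qed.

Lemma ae_witness d (T : measurableType d) (R : realType)
    (m : {measure set T -> \bar R}) (A : set T) (Q : T -> Prop) :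
  measurable A -> m A != 0%E -> {ae m, forall x, Q x} ->
  exists2 x, A x & Q x.
Proof.
move=> mA mA0 [N [mN N0 QN]]; apply: contrapT => noQ.
move/negP : mA0; apply; apply/eqP.
apply: (subset_measure0 _ _ _ N0) => // x Ax; apply: QN => Qx.
by apply: noQ; exists x.
Qed.

Lemma null_subsetU d (T : measurableType d) (R : realType)
    (m : {measure set T -> \bar R}) (A B C : set T) :
  measurable A -> measurable B -> measurable C ->
  A `<=` B `|` C -> m B = 0%E -> m C = 0%E -> m A = 0%E.
Proof.
move=> mA mB mC ABC B0 C0; apply/negligibleP => //.
by apply: negligibleS ABC _; apply: negligibleU; exact/negligibleP.
Qed.

Section null_sections.
Context d1 d2 (T1 : measurableType d1) (T2 : measurableType d2) (R : realType).
Variable m1 : {sigma_finite_measure set T1 -> \bar R}.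
Variable m2 : {sigma_finite_measure set T2 -> \bar R}.
Implicit Types A : set (T1 * T2).

Lemma xsection_mkset A x : xsection A x = [set y | A (x, y)].
Proof. by apply/seteqP; split=> y /=; rewrite /xsection/= inE. Qed.

Lemma ysection_mkset A y : ysection A y = [set x | A (x, y)].
Proof. by apply/seteqP; split=> x /=; rewrite /ysection/= inE. Qed.

Lemma measurable_section1 A x : measurable A -> measurable [set y | A (x, y)].
Proof. by rewrite -xsection_mkset; exact: measurable_xsection. Qed.

Lemma measurable_section2 A y : measurable A -> measurable [set x | A (x, y)].
Proof. by rewrite -ysection_mkset; exact: measurable_ysection. Qed.

Lemma product_measure_eq0P A : measurable A ->
  (m1 \x m2)%E A = 0%E <-> {ae m1, forall x, m2 [set y | A (x, y)] = 0%E}.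
Proof.
move=> mA; rewrite /product_measure1.
have := ae_eq_integral_abs m1 measurableT (measurable_fun_xsection m2 mA).
rewrite (eq_integral (m2 \o xsection A)); last first.
  by move=> x _; rewrite gee0_abs.
move=> ->; split; apply: filterS => x /=; rewrite -xsection_mkset//.
by move=> /(_ I).
Qed.

Lemma ae_section_swap A : measurable A ->
  {ae m1, forall x, m2 [set y | A (x, y)] = 0%E} <->
  {ae m2, forall y, m1 [set x | A (x, y)] = 0%E}.
Proof.
move=> mA; rewrite -product_measure_eq0P//.
have -> : (m1 \x m2)%E A = (\int[m2]_y (m1 \o ysection A) y)%E.
  rewrite /product_measure1 -(indic_fubini_tonelli_FE m2 mA).
  by rewrite indic_fubini_tonelli// indic_fubini_tonelli_GE.
have := ae_eq_integral_abs m2 measurableT (measurable_fun_ysection m1 mA).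
rewrite (eq_integral (m1 \o ysection A)); last first.
  by move=> x _; rewrite gee0_abs.
move=> ->; split; apply: filterS => x /=; rewrite -ysection_mkset//.
by move=> /(_ I).
Qed.

End null_sections.
Arguments ae_section_swap {d1 d2 T1 T2 R} m1 m2 {A}.
Arguments product_measure_eq0P {d1 d2 T1 T2 R} m1 m2 {A}.

(** The null sets of Lebesgue measure are preserved by the group operations, and
this alone makes them stable under preimages by homomorphisms [Q]: by Fubini,
almost every translate of the preimage of [A] is null, hence so is the preimage
itself. Here [F (x, y)] stands for the product of [Q x] and [y], and [theta y]
for the translation which cancels [y]. *)
Lemma null_preimage_hom d1 d2 (T1 : measurableType d1) (T2 : measurableType d2)
    (R : realType) (m1 : {sigma_finite_measure set T1 -> \bar R})
    (m2 : {sigma_finite_measure set T2 -> \bar R}) (F : T1 * T2 -> T2)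
    (Q : T1 -> T2) (theta : T2 -> T1 -> T1) (D A : set T2) :
  measurable_fun setT F -> measurable A -> measurable D -> m2 D != 0%E ->
  (forall x, m2 [set y | A (F (x, y))] = 0%E) ->
  (forall y B, D y -> measurable B -> m1 B = 0%E ->
    m1 [set x | B (theta y x)] = 0%E) ->
  (forall x y, D y -> F (theta y x, y) = Q x) ->
  m1 [set x | A (Q x)] = 0%E.
Proof.
move=> mF mA mD mD0 nullF nullth FQ.
pose Z := [set z | A (F z)].
have mZ : measurable Z by exact: measurable_preimageT.
have aeZ : {ae m1, forall x, m2 [set y | Z (x, y)] = 0%E} by exact: aeW.
have [y Dy Zy0] := ae_witness mD mD0 ((ae_section_swap m1 m2 mZ).1 aeZ).
rewrite -(nullth y _ Dy (measurable_section2 y mZ) Zy0); congr (m1 _).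
by apply/funext => x; rewrite /Z/= FQ.
Qed.

(** * Null sets of the Lebesgue measure of the line *)

Section lebesgue_R.
Context {R : realType}.
Local Notation la := (@lebesgue_measure R).
Implicit Types A : set (measurableTypeR R).

Lemma lebesgue_measure_shift (a : R) A : measurable A ->
  la [set x | A (x + a)] = la A.
Proof.
move=> mA.
have mshift : measurable_fun setT (fun x : R => x + a : measurableTypeR R).
  exact: measurable_funD.
pose shift : {mfun R >-> measurableTypeR R} :=
  HB.pack (fun x : R => x + a : measurableTypeR R)
    (isMeasurableFun.Build _ _ _ _ _ mshift).
apply/esym/(@lebesgue_measure_unique R (pushforward la shift)) => //=.
move=> _ [[b c]] _ <-; rewrite /pushforward.
rewrite (_ : _ @^-1` _ = `](b - a), (c - a)]%classic); last first.
  by apply/seteqP; split=> x /=; rewrite !in_itv/= ltrBlDr lerBrDr.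
rewrite /= !lebesgue_measure_itv/= !lte_fin ltrD2r.
by case: ifP => // _; rewrite -!EFinB opprB addrA subrK.
Qed.

Lemma null_shift (a : R) A : measurable A -> la A = 0%E ->
  la [set x | A (x + a)] = 0%E.
Proof. by move=> mA <-; exact: lebesgue_measure_shift. Qed.

Let gt0_itv : [set s : measurableTypeR R | 0 < s] = `]0, +oo[%classic.
Proof. by apply/seteqP; split=> s; rewrite /= in_itv/= andbT. Qed.

Lemma measurable_gt0 : measurable [set s : measurableTypeR R | 0 < s].
Proof. by rewrite gt0_itv; exact: measurable_itv. Qed.

Lemma lebesgue_measure_gt0_neq0 : la [set s | 0 < s] != 0%E.
Proof. by rewrite gt0_itv lebesgue_measure_itv/= ltry. Qed.

Lemma lebesgue_measureT_neq0 : la setT != 0%E.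
Proof.
apply/eqP => T0; move/eqP: lebesgue_measure_gt0_neq0; apply.
by apply: (subset_measure0 measurable_gt0 _ _ T0).
Qed.

Lemma null_scale (k : R) A : k != 0 -> measurable A -> la A = 0%E ->
  la [set x | A (k * x)] = 0%E.
Proof.
move=> k0 mA A0.
apply: (@null_preimage_hom _ _ (measurableTypeR R) (measurableTypeR R) R la la
    (fun z => z.2 + k * z.1)
    (fun x => k * x) (fun y x => x - k^-1 * y) setT) => //.
- apply: measurable_funD; first exact: measurable_snd.
  by apply: measurable_funM => //; exact: measurable_fst.
- exact: lebesgue_measureT_neq0.
- by move=> x; exact: (@null_shift (k * x)).
- by move=> y B _ mB B0; exact: (@null_shift (- (k^-1 * y))).
- by move=> x y _ /=; rewrite mulrBr mulrA divff// mul1r addrC subrK.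
Qed.

Lemma measurable_set_ltr d (T : measurableType d) (f g : T -> R) :
  measurable_fun setT f -> measurable_fun setT g ->
  measurable [set x | f x < g x].
Proof.
move=> mf mg; rewrite (_ : [set x | _] = [set x | [set true] (f x < g x)]).
  by apply: measurable_preimageT => //; exact: measurable_fun_ltr.
by apply/seteqP; split.
Qed.

Lemma measurable_set_neqr d (T : measurableType d) (f g : T -> R) :
  measurable_fun setT f -> measurable_fun setT g ->
  measurable [set x | f x != g x].
Proof.
move=> mf mg.
rewrite (_ : [set x | _] = ~` [set x | [set true] (f x == g x)]).
  apply: measurableC; apply: measurable_preimageT => //.
  exact: measurable_fun_eqr.
by apply/seteqP; split=> x /=; move/negP.
Qed.

Lemma measurable_fun_sqrt d (T : measurableType d) (g : T -> R) :
  measurable_fun setT g -> measurable_fun setT (fun x => Num.sqrt (g x)).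
Proof.
move=> mg; apply: measurableT_comp => //.
by apply: continuous_measurable_fun; exact: sqrt_continuous.
Qed.

Lemma measurable_fun_inv d (T : measurableType d) (g : T -> R) :
  measurable_fun setT g -> measurable_fun setT (fun x => (g x)^-1).
Proof.
move=> mg; apply: (measurableT_comp _ mg).
rewrite (_ : GRing.inv = fun x : R => if x == 0 then 0 else x^-1); last first.
  by apply/funext => x; case: ifPn => // /eqP ->; rewrite invr0.
apply: measurable_fun_if => //; first exact: measurable_fun_eqr.
rewrite setTI (_ : _ @^-1` _ = ~` [set 0]); last first.
  by apply/seteqP; split=> x /=; [move/negbT/eqP|move/eqP/negPf].
apply: open_continuous_measurable_fun.
  by apply: closed_openC; exact: closed_eq.
by move=> x; rewrite inE/= => /eqP; exact: inv_continuous.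
Qed.

(* Squaring and taking square roots are automorphisms of the multiplicative
   group of positive reals; sets avoiding [0] make the degenerate dilation by
   [0] harmless. *)
Lemma null_sqr A : measurable A -> (forall x, A x -> 0 < x) -> la A = 0%E ->
  la [set x | A (x ^+ 2)] = 0%E.
Proof.
move=> mA Apos A0.
apply: (@null_preimage_hom _ _ (measurableTypeR R) (measurableTypeR R) R la la
    (fun z => z.1 ^+ 2 * z.2)
  (fun x => x ^+ 2) (fun y x => (Num.sqrt y)^-1 * x) [set s | 0 < s]) => //.
- apply: measurable_funM; last exact: measurable_snd.
  by apply: measurable_funX; exact: measurable_fst.
- exact: measurable_gt0.
- exact: lebesgue_measure_gt0_neq0.
- move=> x; have [->|x0] := eqVneq x 0; last first.
    by apply: (@null_scale (x ^+ 2) A) => //; rewrite expf_neq0.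
  rewrite (_ : [set y | _] = set0) ?measure0//.
  by rewrite -subset0 => y /= /Apos; rewrite expr0n mul0r ltxx.
- move=> y B /= y0 mB B0.
  apply: (@null_scale (Num.sqrt y)^-1 B) => //.
  by rewrite invr_eq0 gt_eqF// sqrtr_gt0.
- move=> x y /= y0.
  by rewrite exprMn exprVn sqr_sqrtr ?ltW// mulrAC mulVf ?mul1r// gt_eqF.
Qed.

Lemma null_sqrt A : measurable A -> (forall x, A x -> 0 < x) -> la A = 0%E ->
  la [set x | A (Num.sqrt x)] = 0%E.
Proof.
move=> mA Apos A0.
apply: (@null_preimage_hom _ _ (measurableTypeR R) (measurableTypeR R) R la la
    (fun z => Num.sqrt z.1 * z.2)
  Num.sqrt (fun y x => (y ^+ 2)^-1 * x) [set s | 0 < s]) => //.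
- apply: measurable_funM; last exact: measurable_snd.
  by apply: measurable_fun_sqrt; exact: measurable_fst.
- exact: measurable_gt0.
- exact: lebesgue_measure_gt0_neq0.
- move=> x; have [x0|x0] := eqVneq (Num.sqrt x) 0; last first.
    exact: (@null_scale (Num.sqrt x) A).
  rewrite (_ : [set y | _] = set0) ?measure0//.
  by rewrite -subset0 => y /= /Apos; rewrite x0 mul0r ltxx.
- move=> y B /= y0 mB B0.
  apply: (@null_scale (y ^+ 2)^-1 B) => //.
  by rewrite invr_eq0 expf_neq0// gt_eqF.
- move=> x y /= y0.
  rewrite sqrtrM ?invr_ge0 ?sqr_ge0// sqrtrV ?sqr_ge0// sqrtr_sqr gtr0_norm//.
  by rewrite mulrAC mulVf ?mul1r// gt_eqF.
Qed.

End lebesgue_R.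

(** * Null sets of the Lebesgue measure of Euclidean space *)

Section measurable_matrix_operations.
Context {R : realType} d (T : measurableType d).

Lemma measurable_fun_entry m n (f : T -> 'M[R]_(m, n)) i j :
  measurable_fun setT f -> measurable_fun setT (fun x => f x i j).
Proof. by move=> /measurable_fun_mxP. Qed.

Lemma measurable_fun_addmx m n (f g : T -> 'M[R]_(m, n)) :
  measurable_fun setT f -> measurable_fun setT g ->
  measurable_fun setT (fun x => f x + g x).
Proof.
move=> mf mg; apply/measurable_fun_mxP => i j; under eq_fun do rewrite mxE.
by apply: measurable_funD; exact: measurable_fun_entry.
Qed.

Lemma measurable_fun_scalemx m n (k : T -> R) (f : T -> 'M[R]_(m, n)) :
  measurable_fun setT k -> measurable_fun setT f ->
  measurable_fun setT (fun x => k x *: f x).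
Proof.
move=> mk mf; apply/measurable_fun_mxP => i j; under eq_fun do rewrite mxE.
by apply: measurable_funM => //; exact: measurable_fun_entry.
Qed.

Lemma measurable_fun_mulmx m n q (A : 'M[R]_(m, n)) (f : T -> 'M[R]_(n, q)) :
  measurable_fun setT f -> measurable_fun setT (fun x => A *m f x).
Proof.
move=> mf; apply/measurable_fun_mxP => i j; under eq_fun do rewrite mxE.
apply: measurable_sum => k; apply: measurable_funM => //.
exact: measurable_fun_entry.
Qed.

End measurable_matrix_operations.

Section null_cV.
Context {R : realType}.
Local Notation la := (@lebesgue_measure R).

Lemma ae_shift (a : R) (Q : measurableTypeR R -> Prop) :
  {ae la, forall x, Q x} -> {ae la, forall x, Q (x + a)}.
Proof.
move=> [N [mN N0 QN]]; exists [set x | N (x + a)]; split.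
- apply: measurable_preimageT => //.
  by apply: (@measurable_funD _ _ R).
- exact: null_shift.
- by move=> x /= Qx; exact: QN.
Qed.

Lemma null_translate n (a : 'cV[R]_n) (A : set 'cV[R]_n) :
  measurable A -> lebesgue_cV n A = 0%E ->
  lebesgue_cV n [set x | A (x + a)] = 0%E.
Proof.
elim: n a A => [|n IH] a A mA.
  move=> <-; congr (lebesgue_cV _ _); apply/funext => x /=.
  by congr (A _); apply/colP => -[].
have mcons B : measurable B -> measurable (@cV_cons R n @^-1` B).
  by move=> mB; apply: measurable_preimageT => //; exact: measurable_cV_cons.
have mAa : measurable [set x | A (x + a)].
  by apply: measurable_preimageT => //; exact: measurable_fun_addmx.
pose c z := @cV_cons R n z; pose mu := @lebesgue_cV R n.
have shiftE x v : c (x, v) + a = c (x + a ord0 0, v + (cV_uncons a).2).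
  rewrite -[in LHS](cV_unconsK a); apply/colP => i; rewrite mxE /c.
  by have [j ->|->] := unliftP ord0 i; rewrite ?cV_consS ?cV_cons0//= !mxE.
rewrite [X in X = _ -> _](_ : _ = (la \x mu)%E (c @^-1` A))//.
rewrite [X in _ -> X = _](_ : _ = (la \x mu)%E (c @^-1` [set x | A (x + a)]))//.
move=> /(product_measure_eq0P la mu (mcons _ mA)) A0.
apply/(product_measure_eq0P la mu (mcons _ mAa)).
have FF : Filter (almost_everywhere la) by exact: ae_filter_ringOfSetsType.
have := ae_shift (a ord0 0) A0; apply: filterS => x /= H.
rewrite (_ : [set v | _] =
    [set v | A (c (x + a ord0 0, v + (cV_uncons a).2))]); last first.
  by apply/funext => v /=; rewrite -shiftE.
apply: (IH (cV_uncons a).2 [set v | A (c (x + a ord0 0, v))]) => //.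
exact: (@measurable_section1 _ _ (measurableTypeR R) _ _ (x + a ord0 0)
  (mcons _ mA)).
Qed.

Lemma lebesgue_cVT_neq0 n : lebesgue_cV n [set: 'cV[R]_n] != 0%E.
Proof.
have -> : setT = [set v : 'cV[R]_n | forall i, [set: R] (v i 0)].
  by apply/seteqP.
rewrite (@lebesgue_cV_box R n (fun=> setT))//; elim/big_ind: _ => //.
- by move=> x y x0 y0; rewrite mule_neq0.
- by move=> _ _; exact: lebesgue_measureT_neq0.
Qed.

Lemma null_dilate n (k : R) (A : set 'cV[R]_n) : k != 0 ->
  measurable A -> lebesgue_cV n A = 0%E ->
  lebesgue_cV n [set x | A (k *: x)] = 0%E.
Proof.
move=> k0 mA A0.
apply: (@null_preimage_hom _ _ _ _ R (lebesgue_cV n) (lebesgue_cV n)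
  (fun z => z.2 + k *: z.1) (fun x => k *: x)
  (fun y x => x - k^-1 *: y) setT) => //.
- apply: measurable_fun_addmx; first exact: measurable_snd.
  by apply: measurable_fun_scalemx => //; exact: measurable_fst.
- exact: lebesgue_cVT_neq0.
- by move=> x; exact: (null_translate (k *: x)).
- by move=> y B _ mB B0; exact: (null_translate (- (k^-1 *: y))).
- by move=> x y _ /=; rewrite scalerBr scalerA divff// scale1r addrC subrK.
Qed.

Lemma null_origin n : lebesgue_cV n.+1 [set 0 : 'cV[R]_n.+1] = 0%E.
Proof.
have -> : [set 0] = [set v | forall i, [set 0 : R] ((v : 'cV[R]_n.+1) i 0)].
  apply/seteqP; split=> [_ -> i|v v0]; first by rewrite /= mxE.
  by apply/colP => i; rewrite (v0 i) mxE.
rewrite (@lebesgue_cV_box R n.+1 (fun=> [set 0]))//.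
by rewrite big_ord_recl lebesgue_measure_set1 mul0e.
Qed.

End null_cV.

(** * The law of the direction of a spherical vector *)

Section euclidean.
Context {R : realType} {p : nat}.
Implicit Types (x y e : 'cV[R]_p) (k t : R).

Definition dotv x y : R := \sum_i x i 0 * y i 0.

Definition perp e x := x - dotv e x *: e.

Definition sqdist_line e x : R := dotv (perp e x) (perp e x).

Definition unit_direction x := (enorm x)^-1 *: x.

Lemma dotvC x y : dotv x y = dotv y x.
Proof. by apply: eq_bigr => i _; rewrite mulrC. Qed.

Lemma dotvDr x y z : dotv x (y + z) = dotv x y + dotv x z.
Proof. by rewrite -big_split/=; apply: eq_bigr => i _; rewrite mxE mulrDr. Qed.

Lemma dotvZr k x y : dotv x (k *: y) = k * dotv x y.
Proof. by rewrite mulr_sumr; apply: eq_bigr => i _; rewrite mxE mulrCA. Qed.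

Lemma dotvDl x y z : dotv (x + y) z = dotv x z + dotv y z.
Proof. by rewrite !(dotvC _ z) dotvDr. Qed.

Lemma dotvZl k x y : dotv (k *: x) y = k * dotv x y.
Proof. by rewrite !(dotvC _ y) dotvZr. Qed.

Lemma dotv_ge0 x : 0 <= dotv x x.
Proof. by apply: sumr_ge0 => i _; rewrite -expr2 sqr_ge0. Qed.

Lemma enormE x : enorm x = Num.sqrt (dotv x x).
Proof. by congr Num.sqrt; apply: eq_bigr => i _; rewrite expr2. Qed.

Lemma enormZ k x : 0 <= k -> enorm (k *: x) = k * enorm x.
Proof.
move=> k0; rewrite !enormE dotvZl dotvZr mulrA -expr2 sqrtrM ?sqr_ge0//.
by rewrite sqrtr_sqr ger0_norm.
Qed.

Lemma enorm_gt0 x : x != 0 -> 0 < enorm x.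
Proof.
move=> x0; rewrite enormE sqrtr_gt0 lt_def dotv_ge0 andbT.
apply: contra x0; rewrite psumr_eq0; last first.
  by move=> i _; rewrite -expr2 sqr_ge0.
move=> /allP x0; apply/eqP/colP => i; rewrite mxE; apply/eqP.
by have := x0 i (mem_index_enum i); rewrite /= -expr2 sqrf_eq0.
Qed.

Lemma unit_directionZ k x : 0 < k -> unit_direction (k *: x) = unit_direction x.
Proof.
move=> k0; rewrite /unit_direction enormZ ?ltW// scalerA invfM mulrAC.
by rewrite mulVf ?gt_eqF// mul1r.
Qed.

Lemma perpD e x y : perp e (x + y) = perp e x + perp e y.
Proof. by rewrite /perp dotvDr scalerDl opprD addrACA. Qed.

Lemma perpZ e k x : perp e (k *: x) = k *: perp e x.
Proof. by rewrite /perp dotvZr scalerBr scalerA. Qed.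

Lemma sqdist_lineZ e k x : sqdist_line e (k *: x) = k ^+ 2 * sqdist_line e x.
Proof. by rewrite /sqdist_line perpZ dotvZl dotvZr mulrA expr2. Qed.

Lemma sqdist_line_ge0 e x : 0 <= sqdist_line e x.
Proof. exact: dotv_ge0. Qed.

Lemma enorm_perp_line e x t : dotv e e = 1 ->
  enorm (perp e x + t *: e) = Num.sqrt (sqdist_line e x + t ^+ 2).
Proof.
move=> e1; rewrite enormE; congr Num.sqrt.
have pe : dotv (perp e x) e = 0.
  by rewrite dotvC dotvDr -scaleNr dotvZr e1 mulr1 subrr.
rewrite /sqdist_line; move: (perp e x) pe => u pe.
rewrite dotvDl !dotvDr !dotvZl !dotvZr e1 (dotvC e) pe.
by rewrite !mulr0 addr0 add0r mulr1 expr2.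
Qed.

Lemma measurable_dotv d (T : measurableType d) (f g : T -> 'cV[R]_p) :
  measurable_fun setT f -> measurable_fun setT g ->
  measurable_fun setT (fun w => dotv (f w) (g w)).
Proof.
move=> mf mg; apply: measurable_sum => i.
by apply: measurable_funM; exact: measurable_fun_entry.
Qed.

Lemma measurable_perp e : measurable_fun setT (perp e).
Proof.
apply: measurable_fun_addmx => //.
rewrite (_ : (fun x => - _) = (fun x => - dotv e x *: e)); last first.
  by apply/funext => x; rewrite scaleNr.
apply: measurable_fun_scalemx => //.
apply: (@measurable_funN _ _ _ setT (dotv e)).
exact: (measurable_dotv (measurable_cst e) (@measurable_id _ _ _)).
Qed.

Lemma measurable_sqdist_line e : measurable_fun setT (sqdist_line e).
Proof.
apply: (@measurable_dotv _ _ (perp e) (perp e)); exact: measurable_perp.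
Qed.

Lemma measurable_enorm : measurable_fun setT (@enorm R p).
Proof.
rewrite (_ : enorm = fun x => Num.sqrt (dotv x x)).
  apply: measurable_fun_sqrt.
  exact: (measurable_dotv (@measurable_id _ _ _) (@measurable_id _ _ _)).
by apply/funext => x; exact: enormE.
Qed.

Lemma measurable_unit_direction : measurable_fun setT unit_direction.
Proof.
apply: measurable_fun_scalemx => //; apply: measurable_fun_inv.
exact: measurable_enorm.
Qed.

End euclidean.

Section direction_null_sets.
Context {R : realType} d (T : measurableType d) (P : probability T R).
Context {p' : nat}.
Let p := p'.+1.
Variables (X : {RV P >-> 'cV[R]_p}) (f : R -> R).
Hypothesis X_density :
  has_lebesgue_density X (fun x : 'cV[R]_p => f (enorm x ^+ 2)).
Local Notation la := (@lebesgue_measure R).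
Local Notation mu := (@lebesgue_cV R p).

Let g (x : 'cV[R]_p) := f (enorm x ^+ 2).
Let G := [set x | g x != 0].

Let mg : measurable_fun setT g. Proof. by case: X_density. Qed.

Let mG : measurable G.
Proof.
by apply: measurable_set_neqr.
Qed.

Let law_null N : measurable N ->
  distribution P X N = 0%E <-> mu (N `&` G) = 0%E.
Proof.
move=> mN; case: X_density => _ g0 ->//.
have := ae_eq_integral_abs mu mN
  (measurable_funTS (D := N) ((measurable_EFinP _ _).2 mg)).
rewrite (eq_integral (EFin \o g)); last first.
  by move=> x _; rewrite gee0_abs//= lee_fin; exact: g0.
move=> ->; split.
  move=> [Z [mZ Z0 NZ]]; apply: (subset_measure0 _ _ _ Z0) => //.
    exact: measurableI.
  move=> x [Nx Gx]; apply: NZ => /(_ Nx) [/= gx].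
  by move: Gx; rewrite /G/= gx eqxx.
move=> NG0; exists (N `&` G); split=> //; first exact: measurableI.
move=> x /= /not_implyP[Nx gx]; split => //.
by apply/eqP => gx0; apply: gx; rewrite gx0.
Qed.

Let dilateE (k : R) x : 0 < k -> G (k *: x) <-> f ((k * enorm x) ^+ 2) != 0.
Proof. by move=> k0; rewrite /G/= /g enormZ ?ltW. Qed.

Let measurable_dilate (A : set 'cV[R]_p) : measurable A ->
  measurable [set z : 'cV[R]_p * measurableTypeR R | A (z.2 *: z.1)].
Proof.
move=> mA; apply: measurable_preimageT => //.
by apply: measurable_fun_scalemx; [exact: measurable_snd|exact: measurable_fst].
Qed.

(** If a cone which is null for [X] had positive Lebesgue measure, then Fubini
applied to its dilates would show that the density vanishes almost everywhere on
one ray, hence, being spherical, on every ray; its integral would be [0]. *)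
Lemma null_cone (N : set 'cV[R]_p) : measurable N ->
  (forall k x, 0 < k -> N (k *: x) <-> N x) ->
  distribution P X N = 0%E <-> mu N = 0%E.
Proof.
move=> mN coneN; split; last first.
  by move=> N0; apply/law_null => //; apply: (subset_measure0 _ _ _ N0) => //;
    exact: measurableI.
move=> /(law_null mN) NG0.
pose Z := [set z : 'cV[R]_p * measurableTypeR R |
  0 < z.2 /\ (N `&` G) (z.2 *: z.1)].
have mpos : measurable [set z : 'cV[R]_p * measurableTypeR R | 0 < z.2].
  exact: (measurable_preimageT measurable_snd measurable_gt0).
have mZ : measurable Z.
  by apply: measurableI => //; apply: measurable_dilate; exact: measurableI.
have aeZ : {ae mu, forall x, la [set s | Z (x, s)] = 0%E}.
  apply/(ae_section_swap mu la mZ); apply: aeW => s.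
  have [s0|s0] := ltP 0 s; last first.
    rewrite (_ : [set x | _] = set0) ?measure0//.
    by rewrite -subset0 => x [/=]; rewrite ltNge s0.
  have k0 : s != 0 by rewrite gt_eqF.
  apply: (subset_measure0 _ _ _ (null_dilate k0 _ NG0)).
  - exact: measurable_section2.
  - by apply: measurable_preimageT; [exact: measurable_fun_scalemx|
      exact: measurableI].
  - by move=> x [].
  - exact: measurableI.
apply/eqP; apply: contrapT => /negP N0.
have m0 : measurable [set 0 : 'cV[R]_p].
  rewrite (_ : [set 0] = [set x | [set 0 : R] (enorm x)]).
    by apply: measurable_preimageT => //; exact: measurable_enorm.
  apply/seteqP; split=> x /=.
    by move=> ->; rewrite -(scale0r 0) enormZ// mul0r.
  by move=> x0; apply/eqP; apply: contra_eqT x0 => /enorm_gt0/lt0r_neq0.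
have ND0 : mu (N `\ 0) != 0%E.
  apply: contra_neq N0 => ND0.
  apply: (null_subsetU mN (measurableD mN m0) m0 _ ND0).
    by move=> x Nx; have [->|/eqP x0] := eqVneq x 0; [right|left].
  exact: null_origin.
have [x0 [Nx0 /eqP x0_neq0] Zx0] := ae_witness (measurableD mN m0) ND0 aeZ.
(* The density vanishes almost everywhere on the ray through [x0]. *)
pose S := [set s : measurableTypeR R | Z (x0, s)].
have mS : measurable S by exact: measurable_section1.
have SE s : S s <-> 0 < s /\ f ((s * enorm x0) ^+ 2) != 0.
  split; first by move=> [/= s0 [_ /(dilateE _ s0)]].
  by move=> [s0 fs]; split => //; split; [apply/coneN|apply/dilateE].
pose Z2 := [set z : 'cV[R]_p * measurableTypeR R |
  [/\ 0 < z.2, (~` [set 0]) z.1 & G (z.2 *: z.1)]].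
have mZ2 : measurable Z2.
  rewrite (_ : Z2 = [set z | 0 < z.2] `&` [set z | (~` [set 0]) z.1] `&`
      [set z | G (z.2 *: z.1)]); last first.
    by apply/seteqP; split=> z; [move=> []; split|move=> [[]]; split].
  apply: measurableI; last exact: measurable_dilate.
  apply: measurableI => //; apply: measurable_preimageT; last exact: measurableC.
  exact: measurable_fst.
have aeZ2 : {ae mu, forall x, la [set s | Z2 (x, s)] = 0%E}.
  apply: aeW => x; have [->|xN0] := eqVneq x 0.
    rewrite (_ : [set s | _] = set0) ?measure0//.
    by rewrite -subset0 => s [_ /(_ erefl)].
  pose k := enorm x / enorm x0.
  have k_gt0 : 0 < k by rewrite divr_gt0// enorm_gt0.
  have k0 : k != 0 by rewrite gt_eqF.
  rewrite -[RHS](null_scale k0 mS Zx0); congr (lebesgue_measure _).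
  have ksE s : k * s * enorm x0 = s * enorm x.
    by rewrite mulrC mulrA /k mulrCA divff ?mulr1 1?mulrC// gt_eqF// enorm_gt0.
  apply/seteqP; split=> s /=.
    move=> [/= s0 _ /(dilateE _ s0) fs]; apply/SE.
    by rewrite mulr_gt0// ksE.
  move=> /SE[]; rewrite ksE pmulr_rgt0// => s0 fs.
  by split => //=; [exact/eqP|apply/dilateE].
have [s s0 Zs0] := ae_witness measurable_gt0 lebesgue_measure_gt0_neq0
  ((ae_section_swap mu la mZ2).1 aeZ2).
have si0 : s^-1 != 0 by rewrite invr_eq0 gt_eqF.
have mD : measurable [set x : 'cV[R]_p | Z2 (s^-1 *: x, s)].
  apply: (measurable_preimageT _ mZ2); apply/measurable_fun_pair => //.
  exact: measurable_fun_scalemx.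
have GD0 : mu [set x | Z2 (s^-1 *: x, s)] = 0%E.
  exact: (null_dilate si0 (measurable_section2 s mZ2) Zs0).
suff : distribution P X setT = 0%E.
  by move/eqP; rewrite probability_setT; rewrite eqe oner_eq0.
apply/law_null => //; rewrite setTI.
apply: (null_subsetU mG m0 mD _ _ GD0).
- move=> x Gx; have [->|/eqP xN0] := eqVneq x 0; [by left|right].
  have sK : s *: (s^-1 *: x) = x by rewrite scalerA divff ?scale1r// gt_eqF.
  split=> //=; last by rewrite sK.
  by move=> sx0; apply: xN0; rewrite -sK sx0 scaler0.
- exact: null_origin.
Qed.

End direction_null_sets.

Section cylinder.
Context {R : realType} {p : nat}.
Local Notation la := (@lebesgue_measure R).
Local Notation mu := (@lebesgue_cV R p).
Variables (e : 'cV[R]_p) (M : set 'cV[R]_p).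
Hypotheses (e1 : dotv e e = 1) (mM : measurable M).
Hypothesis Me : forall x t, M (x + t *: e) <-> M x.

Let N := [set x | M (unit_direction x)].
Let q := sqdist_line e.
(* Pairs of a point [x] and a squared norm [s] such that the points of squared
   norm [s] on the line through [x] parallel to [e] belong to the cone. *)
Let L := [set z : 'cV[R]_p * measurableTypeR R |
  q z.1 < z.2 /\ M ((Num.sqrt z.2)^-1 *: z.1)].
Let C := [set x | q x < 1 /\ M x].

Let mN : measurable N.
Proof. exact: measurable_preimageT measurable_unit_direction mM. Qed.

Let mq : measurable_fun setT q.
Proof. exact: measurable_sqdist_line. Qed.

Let mC : measurable C.
Proof. by apply: measurableI => //; exact: measurable_set_ltr. Qed.

Let measurable_snd_la :
  measurable_fun setT (fun z : 'cV[R]_p * measurableTypeR R => z.2 : R).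
Proof. exact: measurable_snd. Qed.

Let mL : measurable L.
Proof.
apply: measurableI.
  by apply: measurable_set_ltr => //; apply: measurableT_comp mq measurable_fst.
apply: measurable_preimageT => //; apply: measurable_fun_scalemx.
  by apply: measurable_fun_inv; exact: measurable_fun_sqrt.
exact: measurable_fst.
Qed.

Let W := [set z : 'cV[R]_p * measurableTypeR R | N (z.1 + z.2 *: e)].

Let mW : measurable W.
Proof.
apply: measurable_preimageT => //; apply: measurable_fun_addmx.
  exact: measurable_fst.
exact: measurable_fun_scalemx.
Qed.

Let lineE x t : perp e x + t *: e = x + (t - dotv e x) *: e.
Proof. by rewrite /perp scalerBl addrA addrAC. Qed.

Let null_lines : mu N = 0%E <-> {ae mu, forall x, la [set t | W (x, t)] = 0%E}.
Proof.
split=> [N0|].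
  apply/(ae_section_swap mu la mW)/aeW => t.
  exact: (null_translate (t *: e) mN N0).
move=> /(ae_section_swap mu la mW) aeW0.
have [t _ Wt] := ae_witness measurableT lebesgue_measureT_neq0 aeW0.
have := null_translate (- (t *: e)) (measurable_section2 t mW) Wt.
by rewrite (_ : [set x | _] = N)//; apply/funext => x; rewrite /W/= subrK.
Qed.

Let lineP x t : W (x, t - dotv e x) <-> M ((Num.sqrt (q x + t ^+ 2))^-1 *: x).
Proof.
rewrite /W/= -lineE /N/= /unit_direction enorm_perp_line// lineE -/(q x).
by rewrite scalerDr scalerA; exact: Me.
Qed.

Let null_line x :
  la [set t | W (x, t)] = 0%E <-> la [set s | L (x, s)] = 0%E.
Proof.
have mWx := measurable_section1 x mW; have mLx := measurable_section1 x mL.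
pose A := [set s : measurableTypeR R | 0 < s /\ L (x, s + q x)].
have q0 : 0 <= q x := sqdist_line_ge0 e x.
have AE s : A s <-> 0 < s /\ M ((Num.sqrt (q x + s))^-1 *: x).
  rewrite /A /L/= (addrC s); split; first by move=> [s0 []].
  by move=> [s0 Ms]; rewrite ltrDl.
have A_gt0 s : A s -> 0 < s by case.
have mLs : measurable [set s : measurableTypeR R | L (x, s + q x)].
  apply: (@measurable_preimageT _ _ (measurableTypeR R) (measurableTypeR R)
    (fun s => s + q x) [set s | L (x, s)]) => //.
  exact: (@measurable_funD _ _ R).
have mA : measurable A.
  by apply: measurableI => //; exact: measurable_gt0.
pose B := [set t : measurableTypeR R | W (x, t - dotv e x)].
have mB : measurable B.
  apply: (@measurable_preimageT _ _ (measurableTypeR R) (measurableTypeR R)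
    (fun t => t - dotv e x) [set s | W (x, s)]) => //.
  exact: (@measurable_funD _ _ R).
have WB : la [set t | W (x, t)] = 0%E <-> la B = 0%E.
  split; first exact: null_shift.
  move=> /(null_shift (dotv e x) mB).
  rewrite (_ : [set t | _] = [set t | W (x, t)])//.
  by apply/funext => t; rewrite /B/= addrK.
have LA : la [set s | L (x, s)] = 0%E <-> la A = 0%E.
  split.
    move=> /(null_shift (q x) mLx) L0.
    by apply: (subset_measure0 mA mLs _ L0) => s [].
  move=> /(null_shift (- q x) mA).
  rewrite (_ : [set t | _] = [set s | L (x, s)])//.
  apply/funext => s; rewrite /A/= subrK subr_gt0; apply/propext.
  by split=> [[]//|Ls]; split=> //; case: Ls.
rewrite WB LA; split=> [B0|A0].
  pose B' := [set t : measurableTypeR R | 0 < t] `&` B.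
  have mB' : measurable B'.
    by apply: measurableI => //; exact: measurable_gt0.
  have B'0 : la B' = 0%E by apply: (subset_measure0 mB' mB _ B0) => t [].
  have B'_gt0 t : B' t -> 0 < t by case.
  have := null_sqrt mB' B'_gt0 B'0; apply: (subset_measure0 mA).
    apply: (@measurable_preimageT _ _ (measurableTypeR R) (measurableTypeR R)
      Num.sqrt B') => //.
    exact: (measurable_fun_sqrt (@measurable_id _ _ _)).
  move=> s /AE[s0 Ms]; split; rewrite /= ?sqrtr_gt0//.
  by apply/lineP; rewrite sqr_sqrtr// ltW.
have m0 : measurable ([set 0] : set (measurableTypeR R)).
  exact: measurable_set1.
apply: (null_subsetU mB m0 _ _ (lebesgue_measure_set1 0) (null_sqr mA A_gt0 A0)).
  apply: (@measurable_preimageT _ _ (measurableTypeR R) (measurableTypeR R)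
    (fun t => t ^+ 2) A) => //.
move=> t Bt; have [->|t0] := eqVneq t 0; [by left|right; apply/AE].
by split; [rewrite exprn_even_gt0|apply/lineP].
Qed.

Let null_slices :
  {ae mu, forall x, la [set s | L (x, s)] = 0%E} <-> mu C = 0%E.
Proof.
have L_slice s : 0 < s ->
    [set x | L (x, s)] = [set x | C ((Num.sqrt s)^-1 *: x)].
  move=> s0; apply/funext => x; rewrite /L/C/= /q sqdist_lineZ exprVn.
  by rewrite sqr_sqrtr ?ltW// mulrC ltr_pdivrMr// mul1r.
split.
  move=> /(ae_section_swap mu la mL) aeL.
  have [s s0 Ls0] := ae_witness measurable_gt0 lebesgue_measure_gt0_neq0 aeL.
  have r0 : Num.sqrt s != 0 by rewrite gt_eqF// sqrtr_gt0.
  have := null_dilate r0 (measurable_section2 s mL) Ls0.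
  rewrite (_ : [set x | _] = C)//; apply/funext => x.
  have := L_slice s s0; rewrite predeqE => /(_ (Num.sqrt s *: x))/= LC.
  by apply/propext; rewrite /= LC scalerA mulVf// scale1r.
move=> C0; apply/(ae_section_swap mu la mL)/aeW => s.
have [s0|s0] := ltP 0 s; last first.
  rewrite (_ : [set x | _] = set0) ?measure0//; rewrite -subset0 => x [/= qs _].
  by have := lt_le_trans qs s0; rewrite ltNge sqdist_line_ge0.
by rewrite L_slice//; apply: null_dilate; rewrite // invr_eq0 gt_eqF// sqrtr_gt0.
Qed.

(** This is polar coordinates for null sets. On the line through [x] parallel to
[e], with [t] the signed distance to the hyperplane orthogonal to [e], the
squared norm is [s = sqdist_line e x + t ^+ 2]; the null sets in [t] and in [s]
correspond. As [M] is invariant along [e], only [x] and [s] matter, and dilating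
the slice of constant [s] to [s = 1] gives the trace of [M] on the open unit
cylinder. *)
Lemma null_cone_cylinder :
  mu [set x | M (unit_direction x)] = 0%E <->
  mu [set x | sqdist_line e x < 1 /\ M x] = 0%E.
Proof.
rewrite -/N -/C null_lines -null_slices; split; apply: filterS => x.
  by move=> /null_line.
by move=> /null_line.
Qed.

End cylinder.

(** * Functions of two projections *)

(** The supremum of the rationals [r] with [B r y]. It builds a measurable
function out of comparisons of its values with the rationals, known even where
the values themselves are only defined up to null sets or up to a choice. *)
Lemma measurable_fun_from_levels {R : realType} d (T : measurableType d)
    (B : rat -> set T) : (forall r, measurable (B r)) ->
  exists h : T -> R, measurable_fun setT h /\
    forall y a, (forall r, B r y <-> ratr r < a) -> h y = a.
Proof.
move=> mB.
pose H y := ereal_sup [set (ratr r : R)%:E | r in [set r | B r y]].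
exists (fine \o H); split.
  apply: measurableT_comp; first exact: fine_measurable.
  apply: (measurability _ (ErealGenOInfty.measurableE R)) => //.
  move=> _ [_ [a ->] <-]; rewrite setTI.
  rewrite [X in measurable X](_ : _ =
      \bigcup_(r in [set r : rat | a < ratr r]) B r); last first.
    apply/seteqP; split=> y /=; rewrite in_itv/= andbT.
      by move=> /ereal_sup_gt[_ [r Br <-]]; rewrite lte_fin; exists r.
    move=> [r /= ar Br]; apply: (@lt_le_trans _ _ (ratr r)%:E).
      by rewrite lte_fin.
    by apply: ereal_sup_ubound; exists r.
  rewrite bigcup_mkcond; apply: bigcupT_measurable_rat => r.
  by case: ifPn.
move=> y a Ba; suff : fine (H y) = fine a%:E by [].
congr fine; apply/eqP; rewrite eq_le; apply/andP; split.
  by apply: ge_ereal_sup => _ [r /Ba ra <-]; rewrite lee_fin ltW.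
rewrite leNgt; apply/negP => Ha.
have [r0 /Ba Br0] : exists r0 : rat, ratr r0 < a.
  have /rat_in_itvoo[r] : a - 1 < a by rewrite gtrBl.
  by rewrite in_itv/= => /andP[_ ra]; exists r.
have : ((ratr r0)%:E <= H y)%E by apply: ereal_sup_ubound; exists r0.
move: Ha; case HE : (H y) => [b| |]//; rewrite lte_fin => ba _.
have [r] := rat_in_itvoo ba; rewrite in_itv/= => /andP[br /Ba Br].
have : ((ratr r)%:E <= H y)%E by apply: ereal_sup_ubound; exists r.
by rewrite HE lee_fin leNgt br.
Qed.

Section cylinder_geometry.
Context {R : realType} {p : nat}.
Variable e : 'cV[R]_p.
Local Notation q := (sqdist_line e).

Lemma sqdist_line_convex (x v : 'cV[R]_p) t : 0 <= t <= 1 ->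
  q (x + t *: v) <= (1 - t) * q x + t * q (x + v).
Proof.
move=> /andP[t0 t1]; rewrite -subr_ge0.
suff -> : (1 - t) * q x + t * q (x + v) - q (x + t *: v) =
    t * (1 - t) * q v.
  by rewrite !mulr_ge0 ?subr_ge0// sqdist_line_ge0.
rewrite /q /sqdist_line !perpD perpZ.
move: (perp e x) (perp e v) => y w.
rewrite !dotvDl !dotvDr !dotvZl !dotvZr (dotvC w y).
by move: (dotv y y) (dotv y w) (dotv w w) => a b c; ring.
Qed.

Let inv_nat_itv n : 0 <= (n.+1%:R^-1 : R) <= 1.
Proof. by rewrite invr_ge0 ler0n/= invf_le1 ?ltr0n// ler1n. Qed.

Let archi_shrink (a b : R) : a < 1 -> 0 <= b ->
  exists n : nat, a + n.+1%:R^-1 * b < 1.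
Proof.
move=> a1 b0; exists (Num.truncn (b / (1 - a))).
rewrite addrC -ltrBrDr ltr_pdivrMl ?ltr0n// -ltr_pdivrMr ?subr_gt0//.
exact: truncnS_gt.
Qed.

Lemma cylinder_shrink (x v : 'cV[R]_p) : q x < 1 ->
  exists n : nat, q (x + n.+1%:R^-1 *: v) < 1.
Proof.
move=> qx; have [n nq] := archi_shrink qx (sqdist_line_ge0 e (x + v)).
exists n; apply: le_lt_trans nq.
apply: le_trans (sqdist_line_convex _ _ _) _ => //.
by rewrite lerD2r ler_piMl ?sqdist_line_ge0// gerBl; case/andP: (inv_nat_itv n).
Qed.

Lemma cylinder_segment (x v : 'cV[R]_p) t : 0 <= t <= 1 ->
  q (x + t *: v) <= Num.max (q x) (q (x + v)).
Proof.
move=> t01; apply: le_trans (sqdist_line_convex x v t01) _.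
have /andP[t0 t1] := t01.
rewrite [leRHS](_ : _ = (1 - t) * Num.max (q x) (q (x + v)) +
  t * Num.max (q x) (q (x + v))); last by ring.
apply: lerD.
  by rewrite ler_wpM2l ?subr_ge0// le_max lexx.
by rewrite ler_wpM2l// le_max lexx orbT.
Qed.

Lemma cylinder_segment_shrink (x v w : 'cV[R]_p) : q x < 1 -> q (x + v) < 1 ->
  exists n : nat, forall t, 0 <= t <= 1 ->
    q (x + t *: v) < 1 /\ q (x + t *: v + n.+1%:R^-1 *: w) < 1.
Proof.
move=> qx qxv; pose b := Num.max (q (x + w)) (q (x + w + v)).
have ab : Num.max (q x) (q (x + v)) < 1 by rewrite gt_max qx.
have b0 : 0 <= b by rewrite le_max sqdist_line_ge0.
have [n nq] := archi_shrink ab b0; exists n => t t01.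
have qt := cylinder_segment x v t01; split; first exact: le_lt_trans qt ab.
apply: le_lt_trans nq.
apply: le_trans (sqdist_line_convex _ _ (inv_nat_itv n)) _.
have /andP[n0 n1] := inv_nat_itv n.
apply: lerD; last first.
  by rewrite ler_wpM2l// addrAC; exact: cylinder_segment.
apply: le_trans qt; rewrite ler_piMl ?sqdist_line_ge0// gerBl//.
Qed.

End cylinder_geometry.

Section two_projections.
Context {R : realType} {p k : nat}.
Local Notation mu := (@lebesgue_cV R p).
Variables (e : 'cV[R]_p) (phi psi : 'cV[R]_p -> R).
Variables (L1 L2 : 'M[R]_p) (E : 'M[R]_(p, k)) (G : 'M[R]_(k, p)).
Hypotheses (mphi : measurable_fun setT phi) (mpsi : measurable_fun setT psi).
Hypothesis phiL1 : forall x s, phi (x + L1 *m s) = phi x.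
Hypothesis psiL2 : forall x s, psi (x + L2 *m s) = psi x.
Hypothesis split1 : 1%:M = L1 + L2 + E *m G.
Hypothesis phi_psi :
  mu [set x | sqdist_line e x < 1 /\ phi x != psi x] = 0%E.

Local Notation q := (sqdist_line e).
Let L := L1 + L2.
Let N := [set x | q x < 1 /\ phi x != psi x].

Let mq d (T : measurableType d) (f : T -> 'cV[R]_p) :
  measurable_fun setT f -> measurable_fun setT (fun x => q (f x)).
Proof. by move=> mf; apply: (measurableT_comp (measurable_sqdist_line e)). Qed.

Let mphi_comp d (T : measurableType d) (f : T -> 'cV[R]_p) :
  measurable_fun setT f -> measurable_fun setT (fun x => phi (f x)).
Proof. by move=> mf; apply: (measurableT_comp mphi). Qed.

Let mN : measurable N.
Proof.
apply: measurableI; last exact: measurable_set_neqr.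
by apply: measurable_set_ltr => //; exact: mq.
Qed.

Let chain (x s : 'cV[R]_p) (n : nat) :
  let u j := x + (j%:R / n.+1%:R) *: (L *m s) in
  (forall j, (j <= n.+1)%N -> q (u j) < 1 /\
     q (u j + n.+1%:R^-1 *: (L1 *m s)) < 1) ->
  (forall j, ~ N (u j) /\ ~ N (u j + n.+1%:R^-1 *: (L1 *m s))) ->
  phi (x + L *m s) = phi x.
Proof.
move=> u qu Nu.
have step j : (j < n.+1)%N -> phi (u j.+1) = phi (u j).
  move=> jn; have [q1 _] := qu j.+1 jn; have [_ q2] := qu j (ltnW jn).
  have [N1 _] := Nu j.+1; have [_ N2] := Nu j.
  have /eqP -> : phi (u j.+1) == psi (u j.+1).
    by apply: contrapT => /negP h; apply: N1.
  have uS : u j.+1 = u j + n.+1%:R^-1 *: (L1 *m s) + L2 *m (n.+1%:R^-1 *: s).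
    rewrite /u -(natr1 j) mulrDl mul1r scalerDl -!addrA; congr (_ + (_ + _)).
    by rewrite -scalemxAr -scalerDr /L mulmxDl.
  rewrite uS psiL2.
  have /eqP <- : phi (u j + n.+1%:R^-1 *: (L1 *m s)) ==
                 psi (u j + n.+1%:R^-1 *: (L1 *m s)).
    by apply: contrapT => /negP h; apply: N2.
  by rewrite scalemxAr phiL1.
have all j : (j <= n.+1)%N -> phi (u j) = phi x.
  elim: j => [|j IH] jn; first by rewrite /u mul0r scale0r addr0.
  by rewrite step// IH// ltnW.
by rewrite -(all n.+1)// /u divff// scale1r.
Qed.

(** To go from [x] to [x + L *m s] inside the convex cylinder, move alternately
along [L1], where [phi] does not change, and along [L2], where [psi] does not
change. The two functions must be exchanged at each turn, so the turning points
must lie in the cylinder: the segment is cut into steps short enough for it. *)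
Lemma ae_shift_invariant (s : 'cV[R]_p) :
  mu [set x | [/\ q x < 1, q (x + L *m s) < 1 & phi x != phi (x + L *m s)]]
    = 0%E.
Proof.
pose a n j := (j%:R / n.+1%:R) *: (L *m s).
pose b n j := a n j + n.+1%:R^-1 *: (L1 *m s).
have mNt v : measurable [set x | N (x + v)].
  by apply: measurable_preimageT mN; exact: measurable_fun_addmx.
apply/negligibleP.
  rewrite (_ : [set x | _] = [set x | q x < 1] `&` [set x | q (x + L *m s) < 1]
      `&` [set x | phi x != phi (x + L *m s)]); last first.
    by apply/seteqP; split=> x /=; [case|case=> -[]].
  apply: measurableI; first apply: measurableI.
  - by apply: measurable_set_ltr => //; exact: mq.
  - by apply: measurable_set_ltr => //; apply: mq; exact: measurable_fun_addmx.
  - apply: measurable_set_neqr => //; apply: mphi_comp.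
    exact: measurable_fun_addmx.
apply: (negligibleS (A := \bigcup_n \bigcup_j
    ([set x | N (x + a n j)] `|` [set x | N (x + b n j)]))); last first.
  apply: negligible_bigcup => n; apply: negligible_bigcup => j.
  by apply: negligibleU; apply/negligibleP => //; exact: null_translate.
move=> x [qx qxs /eqP xs]; apply: contrapT => noN; apply: xs.
have [n Hn] := cylinder_segment_shrink (L1 *m s) qx qxs.
apply/esym/(@chain x s n) => [j jn|j]; last first.
  split=> Nj; apply: noN; exists n => //; exists j => //; first by left.
  by right; rewrite /b/= addrA.
apply: Hn; rewrite divr_ge0 ?ler0n//= ler_pdivrMr ?ltr0n// mul1r.
by rewrite ler_nat.
Qed.

(* A null section would have null dilates, which cover the space. *)
Let positive_section (x : 'cV[R]_p) : q x < 1 ->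
  mu [set s | q (x + L *m s) < 1] != 0%E.
Proof.
move=> qx; apply/eqP => x0; move/eqP: (@lebesgue_cVT_neq0 R p); apply.
have mU : measurable [set s | q (x + L *m s) < 1].
  apply: measurable_set_ltr => //; apply: mq; apply: measurable_fun_addmx => //.
  exact: measurable_fun_mulmx.
apply/negligibleP => //; apply: (negligibleS
    (A := \bigcup_n [set s | q (x + L *m (n.+1%:R^-1 *: s)) < 1])).
  move=> s _; have [n qn] := cylinder_shrink (L *m s) qx.
  by exists n => //=; rewrite -scalemxAr.
apply: negligible_bigcup => n; apply/negligibleP.
  apply: measurable_set_ltr => //; apply: mq; apply: measurable_fun_addmx => //.
  by apply: measurable_fun_mulmx; exact: measurable_fun_scalemx.
by apply: (null_dilate _ mU) => //; rewrite invr_eq0 pnatr_eq0.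
Qed.

(** For almost every [x] of the cylinder, [phi] takes the value [phi x] at
almost every point of the cylinder on the affine space [x + range L]. This value
can thus be read off from the levels which [phi] exceeds on a non-null part of
this affine space, and the latter depends on [G *m x] only. *)
Lemma factor_through_intersection : exists h : 'cV[R]_k -> R,
  measurable_fun setT h /\
  mu [set x | q x < 1 /\ phi x != h (G *m x)] = 0%E.
Proof.
pose F (b : 'cV[R]_k) (s : 'cV[R]_p) := E *m b + L *m s.
have mF : measurable_fun setT (fun z : 'cV[R]_k * 'cV[R]_p => F z.1 z.2).
  apply: measurable_fun_addmx; apply: measurable_fun_mulmx.
    exact: measurable_fst.
  exact: measurable_snd.
pose D r := [set z : 'cV[R]_k * 'cV[R]_p |
  q (F z.1 z.2) < 1 /\ ratr r < phi (F z.1 z.2)].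
have mD r : measurable (D r).
  apply: measurableI; first by apply: measurable_set_ltr => //; exact: mq.
  by apply: measurable_set_ltr => //; exact: mphi_comp.
pose B r := [set b | mu [set s | D r (b, s)] != 0%E].
have mB r : measurable (B r).
  rewrite (_ : B r = ~` [set b | [set 0%E] ((mu \o xsection (D r)) b)]).
    apply: measurableC; apply: measurable_preimageT => //.
    exact: measurable_fun_xsection.
  by apply/seteqP; split=> b /=; rewrite xsection_mkset => /eqP.
have [h [mh hE]] := @measurable_fun_from_levels R _ _ _ mB; exists h; split=> //.
pose Z := [set z : 'cV[R]_p * 'cV[R]_p |
  [/\ q z.1 < 1, q (z.1 + L *m z.2) < 1 & phi z.1 != phi (z.1 + L *m z.2)]].
have mshift : measurable_fun setT
    (fun z : 'cV[R]_p * 'cV[R]_p => z.1 + L *m z.2).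
  apply: measurable_fun_addmx; first exact: measurable_fst.
  by apply: measurable_fun_mulmx; exact: measurable_snd.
have mfst1 : measurable_fun setT (fun z : 'cV[R]_p * 'cV[R]_p => z.1).
  exact: measurable_fst.
have mZ : measurable Z.
  rewrite (_ : Z = [set z | q z.1 < 1] `&` [set z | q (z.1 + L *m z.2) < 1]
      `&` [set z | phi z.1 != phi (z.1 + L *m z.2)]); last first.
    by apply/seteqP; split=> z /=; [case|case=> -[]].
  apply: measurableI; first apply: measurableI.
  - by apply: measurable_set_ltr => //; exact: mq.
  - by apply: measurable_set_ltr => //; exact: mq.
  - by apply: measurable_set_neqr; exact: mphi_comp.
have aeZ : {ae mu, forall x, mu [set s | Z (x, s)] = 0%E}.
  by apply/(ae_section_swap mu mu mZ)/aeW => s; exact: ae_shift_invariant.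
apply/negligibleP.
  apply: measurableI; first by apply: measurable_set_ltr => //; exact: mq.
  apply: measurable_set_neqr => //; apply: measurableT_comp mh _.
  exact: measurable_fun_mulmx.
apply: negligibleS aeZ => x /= [qx /eqP phix] Zx.
apply: phix; apply/esym/hE => r.
(* The shear [s |-> s - x] makes the section depend on [G *m x] only. *)
have FE s : x + L *m (s - x) = F (G *m x) s.
  rewrite /F mulmxA mulmxBr addrCA addrC; congr (_ + _).
  rewrite -[X in X - _]mul1mx -mulmxBl; congr (_ *m _).
  by rewrite split1 -/L addrC addKr.
have mS := measurable_section1 x mZ.
have S0 : mu [set s | Z (x, s - x)] = 0%E.
  exact: (null_translate (- x) mS Zx).
have mSx : measurable [set s | Z (x, s - x)].
  by apply: (measurable_preimageT _ mS); exact: measurable_fun_addmx.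
have mDr := measurable_section1 (G *m x) (mD r).
split.
  move=> /eqP Br; rewrite ltNge; apply/negP => phir; apply: Br.
  apply: (subset_measure0 mDr mSx _ S0) => s [/= qs rs].
  split; rewrite /= ?FE//; apply/eqP => e0.
  by move: rs; rewrite -e0 ltNge phir.
move=> rphi; apply/eqP => Dr0; move/eqP: (positive_section qx); apply.
have mU : measurable [set s | q (x + L *m s) < 1].
  apply: measurable_set_ltr => //; apply: mq; apply: measurable_fun_addmx => //.
  exact: measurable_fun_mulmx.
apply/negligibleP => //.
have mUx : measurable [set s | q (x + L *m (s - x)) < 1].
  by apply: (measurable_preimageT _ mU); exact: measurable_fun_addmx.
have : mu [set s | q (x + L *m (s - x)) < 1] = 0%E.
  apply: (null_subsetU mUx mSx mDr _ S0 Dr0) => s /= qs.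
  have [phis|phis] := eqVneq (phi x) (phi (x + L *m (s - x))); [right|left].
    by split; rewrite /= -FE// -phis.
  by split.
move=> /(null_translate x mUx); rewrite (_ : [set s | _] =
    [set s | q (x + L *m s) < 1]); first by move/negligibleP; apply.
by apply/funext => s /=; rewrite addrK.
Qed.

End two_projections.

(** * Conditional independence through conditional probabilities *)

Lemma ge0_integral_mrestr d (T : measurableType d) (R : realType)
    (m : {measure set T -> \bar R}) (A D : set T) (mA : measurable A)
    (h : T -> \bar R) :
  measurable D -> measurable_fun setT h -> (forall x, 0 <= h x)%E ->
  (\int[mrestr m mA]_(x in D) h x = \int[m]_(x in D `&` A) h x)%E.
Proof.
move=> mD mh h0.
rewrite (@ge0_negligible_integral _ _ _ _ D (~` A))//.
- rewrite setDE setCK; apply: eq_measure_integral => B mB BA.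
  by rewrite /= /mrestr setIidl// => x /BA[].
- exact: measurableC.
- exact: measurable_funTS.
- by rewrite /= /mrestr setICl measure0.
Qed.

Section restricted_law.
Context {R : realType} d (T : measurableType d) (P : probability T R).
Context d' (T' : measurableType d') (V : {mfun T >-> T'}).
Variables (A : set T) (mA : measurable A).

Definition restricted_law : set T' -> \bar R := pushforward (mrestr P mA) V.

Let mV : measurable_fun setT V. Proof. exact: measurable_funP. Qed.

Let restricted_law0 : restricted_law set0 = 0%E.
Proof. by rewrite /restricted_law /pushforward preimage_set0 measure0. Qed.

Let restricted_law_ge0 S : (0 <= restricted_law S)%E.
Proof. exact: measure_ge0. Qed.

Let restricted_law_sigma_additive : semi_sigma_additive restricted_law.
Proof. exact: measure_semi_sigma_additive. Qed.

HB.instance Definition _ := isMeasure.Build _ _ _ restricted_law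
  restricted_law0 restricted_law_ge0 restricted_law_sigma_additive.

Let restricted_law_fin : fin_num_fun restricted_law.
Proof.
move=> S mS; rewrite /restricted_law /pushforward /mrestr.
apply: fin_num_measure; apply: measurableI => //.
exact: measurable_preimageT mV mS.
Qed.

HB.instance Definition _ := Measure_isFinite.Build _ _ _ restricted_law
  restricted_law_fin.

End restricted_law.

Section conditional_probability.
Context {R : realType} d (T : measurableType d) (P : probability T R).
Context d' (T' : measurableType d') (V : {mfun T >-> T'}).
Implicit Types (A : set T) (S : set T') (r : T' -> R).

Let mV : measurable_fun setT V. Proof. exact: measurable_funP. Qed.

(** A version of [P(A | V)] expressed as a function of the value of [V], so that
the conditionings by different functions of [V] can be compared. *)
Definition cond_density A r := [/\ measurable_fun setT r, forall y, 0 <= r y &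
  forall S, measurable S ->
    (\int[P]_(w in V @^-1` S) (r (V w))%:E)%E = P (A `&` V @^-1` S)].

Let measurable_preV S : measurable S -> measurable (V @^-1` S).
Proof. exact: measurable_preimageT mV. Qed.

(** Existence is the Radon-Nikodym theorem for the law of [V] restricted to [A]
with respect to the law of [V]; the last property is the change of measure
formula, that is, the extraction of a [V]-measurable factor. *)
Lemma cond_density_ex A : measurable A -> exists r, cond_density A r /\
  forall h S, measurable_fun setT h -> (forall y, 0 <= h y)%E -> measurable S ->
    (\int[P]_(w in V @^-1` S) (h (V w) * (r (V w))%:E) =
     \int[P]_(w in V @^-1` S `&` A) h (V w))%E.
Proof.
move=> mA.
pose nu := restricted_law P V mA.
pose mu := distribution P V.
have nu_mu : nu `<< mu.
  apply/null_content_dominatesP => S mS muS0.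
  have mVS := measurable_preV mS.
  exact: (subset_measure0 (measurableI _ _ mVS mA) mVS (@subIsetl _ _ _) muS0).
pose g := Radon_Nikodym_SigmaFinite.f nu mu.
have g0 y : (0 <= g y)%E by exact: Radon_Nikodym_SigmaFinite.f_ge0.
have gfin y : g y \is a fin_num by exact: Radon_Nikodym_SigmaFinite.f_fin_num.
have mg : measurable_fun setT g.
  exact: measurable_int (Radon_Nikodym_SigmaFinite.f_integrable nu_mu).
pose r y := fine (g y).
have rE y : (r y)%:E = g y by rewrite fineK.
have change h S :
    measurable_fun setT h -> (forall y, 0 <= h y)%E -> measurable S ->
    (\int[P]_(w in V @^-1` S) (h (V w) * (r (V w))%:E) =
     \int[P]_(w in V @^-1` S `&` A) h (V w))%E.
  move=> mh h0 mS.
  transitivity (\int[mu]_(y in S) (h y * g y))%E.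
    rewrite ge0_integral_pushforward//.
    - by apply: eq_integral => w _; rewrite rE.
    - by apply: measurable_funTS; exact: emeasurable_funM.
    - by move=> y _; rewrite mule_ge0.
  rewrite (Radon_Nikodym_SigmaFinite.change_of_variables nu_mu)//; last first.
    exact: measurable_funTS.
  rewrite -(ge0_integral_mrestr P mA)//.
  - by rewrite ge0_integral_pushforward//; exact: measurable_funTS.
  - exact: measurable_preV.
  - exact: measurableT_comp.
exists r; split=> //; split.
- by apply: measurableT_comp => //; exact: fine_measurable.
- by move=> y; rewrite fine_ge0.
move=> S mS; have := change (cst 1%E) S (measurable_cst _) (fun=> lee01) mS.
rewrite integral_cst ?mul1e; last first.
  by apply: measurableI => //; exact: measurable_preV.
by rewrite setIC => <-; apply: eq_integral => w _; rewrite mul1e.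
Qed.

Let measurable_comp_sigma r : measurable_fun setT r ->
  @measurable_fun _ _ (g_sigma_algebra_preimageType V) R setT (r \o V).
Proof.
move=> mr _ B mB; rewrite setTI; exists (r @^-1` B); last by rewrite setTI.
exact: measurable_preimageT mr mB.
Qed.

Lemma cond_density_integrable A r : measurable A -> cond_density A r ->
  P.-integrable setT (EFin \o (r \o V)).
Proof.
move=> mA [mr r0 rP]; apply/integrableP; split.
  by apply/measurable_EFinP; exact: measurableT_comp.
rewrite (eq_integral (fun w => (r (V w))%:E)); last first.
  by move=> w _; rewrite /= ger0_norm.
have := rP setT measurableT; rewrite preimage_setT => ->.
by rewrite setIT ltey_eq fin_num_measure.
Qed.

Lemma cond_prob_of_density A r : measurable A -> cond_density A r ->
  cond_prob P V A (r \o V).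
Proof.
move=> mA rA; have rint := cond_density_integrable mA rA.
case: rA => mr r0 rP; split=> //; first exact: measurable_comp_sigma.
by move=> _ [S mS <-]; rewrite setTI rP.
Qed.

(** Doob and Dynkin: the levels of [g] are preimages under [V], so [g] is a
function [h] of [V]. Then [h] and [r] have the same integrals for the law of
[V]. *)
Lemma cond_prob_density A r g : measurable A -> cond_density A r ->
  cond_prob P V A g -> {ae P, forall w, g w = r (V w)}.
Proof.
move=> mA rA [mg gint gP]; have rint := cond_density_integrable mA rA.
have {rA} [mr r0 rP] := rA.
have levels q : exists S : set T', measurable S /\
    forall w, S (V w) <-> (ratr q : R) < g w.
  have [//||S mS SE] := mg _ `]ratr q, +oo[%classic; first exact: measurable_itv.
  exists S; split=> // w; move: SE; rewrite !setTI predeqE => /(_ w)/=.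
  by rewrite in_itv/= andbT.
have [B HB] := choice levels.
have [h [mh hE]] := @measurable_fun_from_levels R _ _ _ (fun q => (HB q).1).
have gE w : g w = h (V w) by apply/esym/hE => q; exact: (HB q).2.
pose mu := distribution P V.
have hint : P.-integrable setT ((EFin \o h) \o V).
  by apply: eq_integrable gint => // w _; rewrite /= gE.
have : ae_eq mu setT (EFin \o r) (EFin \o h).
  apply: integral_ae_eq => //.
  - by apply: (integrable_pushforward mV); [exact/measurable_EFinP|
      rewrite preimage_setT|].
  - exact/measurable_EFinP.
  move=> S _ mS; rewrite !(integral_pushforward mV)//.
  - rewrite rP// -gP; last by exists S => //; rewrite setTI.
    by apply: eq_integral => w _; rewrite /= gE.
  - exact/measurable_EFinP.
  - by apply: integrableS hint => //; exact: measurable_preV.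
  - exact/measurable_EFinP.
  - by apply: integrableS rint => //; exact: measurable_preV.
move=> [N [mN N0 rhN]]; exists (V @^-1` N); split.
- exact: measurable_preV.
- exact: N0.
- move=> w /= gr; apply: rhN => /= /(_ I)[rh]; apply: gr.
  by rewrite gE rh.
Qed.

End conditional_probability.

(** With [V] a function of [U2], and [E], [A] events of [U1] and [U2], the
expectation of [P(E | V) P(A | V)] is the integral of [P(E | V)] over [A]. It
is [P(E A)] for all [A] exactly when [P(E | V)] is a version of [P(E | U2)]. *)
Lemma cond_indepP (R : realType) d (T : measurableType d) (P : probability T R)
    d1 d2 d3 (T1 : measurableType d1) (T2 : measurableType d2)
    (T3 : measurableType d3) (U1 : {mfun T >-> T1}) (U2 : {mfun T >-> T2})
    (G : T2 -> T3) : measurable_fun setT G ->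
  cond_indep P U1 U2 (fun w => G (U2 w)) <->
  forall A1, measurable A1 -> exists h, measurable_fun setT h /\
    cond_density P U2 (U1 @^-1` A1) (fun u => h (G u)).
Proof.
move=> mG.
have mU1 : measurable_fun setT U1 by exact: measurable_funP.
have mU2 : measurable_fun setT U2 by exact: measurable_funP.
have mGU2 : measurable_fun setT (fun w => G (U2 w)) by exact: measurableT_comp.
pose V : {mfun T >-> T3} := HB.pack (fun w => G (U2 w))
  (isMeasurableFun.Build _ _ _ _ _ mGU2).
rewrite -[fun w => G (U2 w)]/(V : T -> T3).
split=> [ci A1 mA1|dens A1 A2 mA1 mA2].
  have mE : measurable (U1 @^-1` A1) by exact: measurable_preimageT.
  have [h [hE hchange]] := cond_density_ex P V mE.
  have [mh h0 hP] := hE.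
  exists h; split=> //; split=> //; first exact: measurableT_comp.
  move=> A2 mA2.
  have mA : measurable (U2 @^-1` A2) by exact: measurable_preimageT.
  have [r2 [r2A r2change]] := cond_density_ex P V mA.
  have [mr2 r20 r2P] := r2A.
  have [g1 [g2 [g12 [g1P g2P [mg12 g12int g12P] g12E]]]] := ci A1 A2 mA1 mA2.
  have g1h := cond_prob_density mE hE g1P.
  have g2r := cond_prob_density mA r2A g2P.
  have := g12P setT; rewrite setIT => <-; last first.
    by exists setT => //; rewrite setTI.
  have := r2change (EFin \o h) setT; rewrite preimage_setT setTI => <-//.
  - apply: ae_eq_integral => //.
    + apply: emeasurable_funM; apply/measurable_EFinP => //;
      exact: measurableT_comp.
    + exact: measurable_int g12int.
    + apply: filterS3 g1h g2r g12E => w /= e1 e2 -> _.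
      by rewrite -e1 -e2 -EFinM.
  - exact/measurable_EFinP.
have mE : measurable (U1 @^-1` A1) by exact: measurable_preimageT.
have mA : measurable (U2 @^-1` A2) by exact: measurable_preimageT.
have [h [mh [mhG h0 hP]]] := dens A1 mA1.
have [r1 [r1E r1change]] := cond_density_ex P V mE.
have [r2 [r2A r2change]] := cond_density_ex P V mA.
have [[mr1 r10 r1P] [mr2 r20 r2P]] := (r1E, r2A).
pose hp y := Num.max (h y) 0.
have hpG u : hp (G u) = h (G u) by rewrite /hp; apply/max_idPl.
have mhp : measurable_fun setT hp by exact: measurable_maxr.
have hpE : cond_density P V (U1 @^-1` A1) hp.
  split=> //; first by move=> y; rewrite /hp le_max lexx orbT.
  move=> S mS; rewrite -(hP (G @^-1` S)); last exact: measurable_preimageT mG mS.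
  by apply: eq_integral => w _; rewrite /= hpG.
have hr2 : cond_density P V (U1 @^-1` A1 `&` U2 @^-1` A2) (fun y => hp y * r2 y).
  split; [exact: measurable_funM| |].
    by move=> y; rewrite mulr_ge0// /hp le_max lexx orbT.
  move=> S mS; have := r2change (EFin \o hp) S; rewrite /= => e12.
  under eq_integral do rewrite EFinM.
  rewrite e12//; last 2 first.
    exact/measurable_EFinP.
    by move=> y; rewrite lee_fin /hp le_max lexx orbT.
  have := hP (G @^-1` S `&` A2); rewrite preimage_setI => hPS.
  rewrite -setIA (setIC (U2 @^-1` A2)) -hPS; last first.
    by apply: measurableI => //; exact: measurable_preimageT mG mS.
  by apply: eq_integral => w _; rewrite hpG.
exists (hp \o V), (r2 \o V), ((fun y => hp y * r2 y) \o V); split.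
- exact: cond_prob_of_density.
- exact: cond_prob_of_density.
- by apply: cond_prob_of_density => //; exact: measurableI.
- exact: aeW.
Qed.

(** * Subspaces and matrices *)

Section colspaces.
Context {R : realType} {p : nat}.

Lemma mem_colspace k (B : 'M[R]_(p, k)) v :
  (v \in colspace B) = (v^T <= B^T)%MS.
Proof.
apply/idP/idP=> [|/submxP[c /(congr1 trmx)]]; last first.
  rewrite trmxK trmx_mul trmxK => ->.
  have -> : B *m c^T = \sum_j c 0 j *: col j B.
    apply/colP => i; rewrite summxE mxE; apply: eq_bigr => j _.
    by rewrite !mxE mulrC.
  apply: memv_suml => j _; apply: memvZ; apply: memv_span.
  by apply: map_f; rewrite mem_enum.
rewrite /colspace; set s := map _ _ => vs.
rewrite (coord_span (X := in_tuple s) vs) linear_sum/=.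
apply: summx_sub => i _; rewrite linearZ/=; apply: scalemx_sub.
have /mapP[j _ ->] : (in_tuple s)`_i \in s by rewrite mem_nth.
by rewrite tr_col row_sub.
Qed.

Lemma colspace_surj (U : {vspace 'cV[R]_p}) :
  exists k (B : 'M[R]_(p, k)), U = colspace B.
Proof.
exists (\dim U), (\matrix_(i, j) tnth (vbasis U) j i 0).
rewrite -[LHS](span_basis (vbasisP U)) /colspace; congr (span _).
rewrite -[LHS]map_tnth_enum; apply: eq_map => j.
by apply/colP => i; rewrite !mxE.
Qed.

Variables (k1 k2 k3 : nat).
Variables (B1 : 'M[R]_(p, k1)) (B2 : 'M[R]_(p, k2)) (B3 : 'M[R]_(p, k3)).

Lemma colspaceD_mem (v : 'cV[R]_p) :
  (v \in (colspace B1 + colspace B2)%VS) = (v^T <= B1^T + B2^T)%MS.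
Proof.
apply/idP/idP => [/memv_addP[u1 + [u2 + ->]]|/sub_addsmxP[[u1 u2] /= vE]].
  rewrite !mem_colspace => u1B u2B; rewrite linearD/=.
  by apply: addmx_sub_adds.
have -> : v = (u1 *m B1^T)^T + (u2 *m B2^T)^T by rewrite -linearD/= -vE trmxK.
by apply: memv_add; rewrite mem_colspace trmxK submxMl.
Qed.

Lemma common_orthogonal_vector : (colspace B1 + colspace B2)%VS != fullv ->
  exists e : 'cV[R]_p, [/\ dotv e e = 1, B1^T *m e = 0 & B2^T *m e = 0].
Proof.
move=> nfull.
have : kermx (row_mx B1 B2) != 0.
  apply: contra nfull; rewrite kermx_eq0 -row_leq_rank => rB.
  rewrite eqEsubv subvf; apply/subvP => v _; rewrite colspaceD_mem.
  apply: submx_full; rewrite /row_full eqn_leq rank_leq_col/=.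
  by rewrite addsmxE -tr_row_mx mxrank_tr.
move=> /rowV0Pn[u /sub_kermxP]; rewrite mul_mx_row => uB u0.
have [uB1 uB2] : u *m B1 = 0 /\ u *m B2 = 0.
  by apply: eq_row_mx; rewrite row_mx0.
pose n := enorm u^T; have n0 : 0 < n.
  by apply: enorm_gt0; rewrite -trmx0 (inj_eq trmx_inj).
exists (n^-1 *: u^T); split.
- rewrite dotvZl dotvZr mulrA -invfM -expr2 /n enormE sqr_sqrtr ?dotv_ge0//.
  by rewrite mulVf// gt_eqF// -sqrtr_gt0 -enormE.
- by rewrite -scalemxAr -trmx_mul uB1 trmx0 scaler0.
- by rewrite -scalemxAr -trmx_mul uB2 trmx0 scaler0.
Qed.

Hypothesis B3E : colspace B3 = (colspace B1 :&: colspace B2)%VS.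

Let B3_cap : (B3^T :=: B1^T :&: B2^T)%MS.
Proof.
apply/eqmxP/andP; split; apply/rV_subP => u; rewrite sub_capmx;
  by rewrite -[u]trmxK -!mem_colspace B3E memv_cap.
Qed.

(* The converse inclusion holds because [B3] factors through [B1] and [B2], and
   the ranks agree. *)
Let kermx_cap : (kermx B3 <= kermx B1 + kermx B2)%MS.
Proof.
have sub_ker k (B : 'M[R]_(p, k)) :
    (B3^T <= B^T)%MS -> (kermx B <= kermx B3)%MS.
  move=> /submxP[D /(congr1 trmx)]; rewrite trmxK trmx_mul trmxK => ->.
  by apply/sub_kermxP; rewrite mulmxA mulmx_ker mul0mx.
have sub12 : (kermx B1 + kermx B2 <= kermx B3)%MS.
  by rewrite addsmx_sub !sub_ker// B3_cap ?capmxSl ?capmxSr.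
have [_] := mxrank_leqif_sup sub12.
suff -> : \rank (kermx B1 + kermx B2) = \rank (kermx B3) by rewrite eqxx => <-.
have kerU : (kermx B1 :&: kermx B2 :=: kermx (row_mx B1 B2))%MS.
  apply/eqmxP/andP; split; apply/rV_subP => u; rewrite sub_capmx.
    move=> /andP[/sub_kermxP u1 /sub_kermxP u2]; apply/sub_kermxP.
    by rewrite mul_mx_row u1 u2 row_mx0.
  move=> /sub_kermxP; rewrite mul_mx_row -[0]row_mx0 => /eq_row_mx[u1 u2].
  by apply/andP; split; apply/sub_kermxP.
have rB : (\rank (row_mx B1 B2) + \rank B3 = \rank B1 + \rank B2)%N.
  have := mxrank_sum_cap B1^T B2^T.
  by rewrite -B3_cap addsmxE -tr_row_mx !mxrank_tr.
have := mxrank_sum_cap (kermx B1) (kermx B2).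
rewrite kerU !mxrank_ker.
have := rank_leq_row B1; have := rank_leq_row B2; have := rank_leq_row B3.
have := rank_leq_row (row_mx B1 B2).
lia.
Qed.

(** The columns of [1 - E *m B3^T], with [E] a generalized inverse, are
orthogonal to the intersection, hence split along the two orthogonal
complements. The matrices [L1] and [L2] parametrize the directions which the two
projections ignore. *)
Lemma intersection_splitting :
  exists (L1 L2 : 'M[R]_p) (E : 'M[R]_(p, k3)),
    [/\ B1^T *m L1 = 0, B2^T *m L2 = 0 & 1%:M = L1 + L2 + E *m B3^T].
Proof.
pose E := pinvmx B3^T; pose L := 1%:M - E *m B3^T.
have B3L : L^T *m B3 = 0.
  apply: trmx_inj; rewrite trmx_mul trmxK trmx0 mulmxBr mulmx1 mulmxA.
  by rewrite mulmxKpV// subrr.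
have /sub_addsmxP[[u1 u2] /= LE] : (L^T <= kermx B1 + kermx B2)%MS.
  by apply: submx_trans kermx_cap; apply/sub_kermxP.
exists (u1 *m kermx B1)^T, (u2 *m kermx B2)^T, E; split.
- by rewrite -trmx_mul -mulmxA mulmx_ker mulmx0 trmx0.
- by rewrite -trmx_mul -mulmxA mulmx_ker mulmx0 trmx0.
- by rewrite -linearD/= -LE trmxK subrK.
Qed.

End colspaces.

(** * Intersections of sufficient contour subspaces *)

Section density_versions.
Context {R : realType} d (T : measurableType d) (P : probability T R).
Context d' (T' : measurableType d') (V : {mfun T >-> T'}) (A : set T).
Hypothesis mA : measurable A.
Let mV : measurable_fun setT V. Proof. exact: measurable_funP. Qed.
Let mu := distribution P V.

Lemma cond_density_unique r r' :
  cond_density P V A r -> cond_density P V A r' ->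
  mu [set y | r y != r' y] = 0%E.
Proof.
move=> rA r'A.
have := cond_prob_density mA rA (cond_prob_of_density mA r'A).
have [[mr _ _] [mr' _ _]] := (rA, r'A).
move=> rr'; rewrite /mu/= /distribution /pushforward.
apply/negligibleP.
  apply: measurable_preimageT mV _.
  exact: measurable_set_neqr.
by apply: negligibleS rr' => w /= /eqP rr' rw; apply: rr'.
Qed.

Lemma cond_density_ae (r r' : T' -> R) : cond_density P V A r ->
  measurable_fun setT r' -> (forall y, 0 <= r' y) ->
  {ae mu, forall y, r y = r' y} -> cond_density P V A r'.
Proof.
move=> [mr r0 rP] mr' r'0 [N [mN N0 rN]]; split=> // S mS; rewrite -rP//.
apply: ge0_ae_eq_integral.
- exact: measurable_preimageT mV mS.
- by apply: measurable_funTS; apply/measurable_EFinP; exact: measurableT_comp.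
- by apply: measurable_funTS; apply/measurable_EFinP; exact: measurableT_comp.
- by move=> w _; rewrite lee_fin.
- by move=> w _; rewrite lee_fin.
exists (V @^-1` N); split.
- exact: measurable_preimageT mV mN.
- exact: N0.
- move=> w /= rw; apply: rN => /= rw'; apply: rw => _; by rewrite rw'.
Qed.

End density_versions.

Section intersection.
Context {R : realType} d (T : measurableType d) (P : probability T R).
Context {p' : nat}.
Let p := p'.+1.
Variables (Y : {RV P >-> R}) (X : {RV P >-> 'cV[R]_p}) (f : R -> R).
Hypothesis X_density :
  has_lebesgue_density X (fun x : 'cV[R]_p => f (enorm x ^+ 2)).

Let mdirection : measurable_fun setT (direction X).
Proof. exact: measurableT_comp measurable_unit_direction _. Qed.

Let D : {mfun T >-> 'cV[R]_p} :=
  HB.pack (direction X) (isMeasurableFun.Build _ _ _ _ _ mdirection).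

Let scs_densities k (B : 'M[R]_(p, k)) :
  cond_indep P Y (direction X) (fun w => B^T *m direction X w) <->
  forall A1, measurable A1 -> exists h, measurable_fun setT h /\
    cond_density P D (Y @^-1` A1) (fun u => h (B^T *m u)).
Proof.
apply: (@cond_indepP R _ T P _ _ _ _ _ _ Y D (fun u => B^T *m u)).
exact: measurable_fun_mulmx.
Qed.

Let direction_null (e : 'cV[R]_p) (M : set 'cV[R]_p) :
  dotv e e = 1 -> measurable M -> (forall x t, M (x + t *: e) <-> M x) ->
  distribution P D M = 0%E <->
  lebesgue_cV p [set x | sqdist_line e x < 1 /\ M x] = 0%E.
Proof.
move=> e1 mM Me.
rewrite -(null_cone_cylinder e1 mM Me) -(null_cone X_density)//.
- exact: measurable_preimageT measurable_unit_direction mM.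
- by move=> k x k0 /=; rewrite unit_directionZ.
Qed.

(** A unit vector [e] orthogonal to the sum makes all the projections involved
invariant along [e], so that equality for almost every direction means equality
almost everywhere on the cylinder around [e]. There the conditional probability
of an event of [Y] is a function of each of the two projections, hence of the
projection on the intersection. *)
Lemma is_SCS_cap (S1 S2 : {vspace 'cV[R]_p}) :
  is_SCS Y X S1 -> is_SCS Y X S2 -> (S1 + S2)%VS != fullv ->
  is_SCS Y X (S1 :&: S2)%VS.
Proof.
move=> [k1 [B1 [-> /scs_densities dens1]]] [k2 [B2 [-> /scs_densities dens2]]].
move=> /common_orthogonal_vector[e [e1 B1e B2e]].
have [k3 [B3 B3E]] := colspace_surj (colspace B1 :&: colspace B2)%VS.
exists k3, B3; split=> //; apply/scs_densities => A1 mA1.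
have [L1 [L2 [E [B1L1 B2L2 split1]]]] := intersection_splitting (esym B3E).
have B3e : B3^T *m e = 0.
  (* The columns of [B3] belong to [colspace B1]. *)
  have /submxP[c cE] : (B3^T <= B1^T)%MS.
    apply/rV_subP => u; rewrite -[u]trmxK -!mem_colspace -B3E memv_cap.
    by case/andP.
  by rewrite cE -mulmxA B1e mulmx0.
have mE : measurable (Y @^-1` A1).
  by apply: measurable_preimageT mA1; exact: measurable_funP.
have [h1 [mh1 h1A]] := dens1 A1 mA1; have [h2 [mh2 h2A]] := dens2 A1 mA1.
pose phi k (B : 'M[R]_(p, k)) (h : 'cV[R]_k -> R) (u : 'cV[R]_p) :=
  h (B^T *m u).
have mphi k (B : 'M[R]_(p, k)) (h : 'cV[R]_k -> R) : measurable_fun setT h ->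
    measurable_fun setT (phi k B h).
  by move=> mh; apply: measurableT_comp mh _; exact: measurable_fun_mulmx.
have mneq k (B : 'M[R]_(p, k)) (h : 'cV[R]_k -> R) : measurable_fun setT h ->
    measurable [set u | phi k1 B1 h1 u != phi k B h u].
  by move=> mh; apply: measurable_set_neqr; exact: mphi.
have inv k (B : 'M[R]_(p, k)) (h : 'cV[R]_k -> R) : B^T *m e = 0 -> forall x t,
    [set u | phi k1 B1 h1 u != phi k B h u] (x + t *: e) <->
    [set u | phi k1 B1 h1 u != phi k B h u] x.
  move=> Be x t; rewrite /phi/= !mulmxDr -!scalemxAr B1e Be.
  by rewrite !scaler0 !addr0.
have := cond_density_unique mE h1A h2A.
move=> /(direction_null e1 (mneq _ _ _ mh2) (inv _ _ _ B2e)) N12.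
have [|||h [mh N13]] := @factor_through_intersection R p k3 e (phi k1 B1 h1)
  (phi k2 B2 h2) L1 L2 E B3^T (mphi _ _ _ mh1) (mphi _ _ _ mh2) _ _ split1.
- by move=> x s; rewrite /phi mulmxDr mulmxA B1L1 mul0mx addr0.
- by move=> x s; rewrite /phi mulmxDr mulmxA B2L2 mul0mx addr0.
- exact: N12.
have {}N13 : distribution P D [set u | phi k1 B1 h1 u != phi k3 B3 h u] = 0%E.
  by apply/(direction_null e1 (mneq _ _ _ mh) (inv _ _ _ B3e)).
(* The values of [h] outside the range of the directions are arbitrary. *)
exists (fun y => Num.max (h y) 0).
have mhp : measurable_fun setT (fun y => Num.max (h y) 0).
  exact: measurable_maxr.
split=> //; apply: (cond_density_ae h1A).
- exact: (mphi _ B3 _ mhp).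
- by move=> u; rewrite le_max lexx orbT.
exists [set u | phi k1 B1 h1 u != phi k3 B3 h u]; split=> //; first exact: mneq.
have [_ h1_ge0 _] := h1A.
move=> u /= h1u; apply/eqP => h1h; apply: h1u.
rewrite /phi in h1h; rewrite -h1h; apply/esym/max_idPl; exact: h1_ge0.
Qed.

End intersection.

Unset Implicit Arguments.

Theorem theorem2 (R : realType) (d : measure_display) (T : measurableType d)
    (P : probability T R) (p : nat) (p_gt1 : (1 < p)%N)
    (Y : {RV P >-> R}) (X : {RV P >-> 'cV[R]_p}) (f : R -> R)
    (X_density : has_lebesgue_density X (fun x : 'cV[R]_p => f (enorm x ^+ 2))) :
  (forall d0 : nat, is_min_SCS_dim Y X d0 ->
     (exists S, [/\ is_SCS Y X S, \dim S = d0 &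
        d0%:R < (p%:R + (\dim (kernel_contour_subspace Y X))%:R) / 2 :> R]) ->
     exists! G, is_GCS Y X G) /\
  (forall C, is_CCS Y X C ->
     (forall G, is_GCS Y X G -> G = C) /\ exists! G, is_GCS Y X G).
Proof.
have kernel_sub S : is_SCS Y X S -> (kernel_contour_subspace Y X <= S)%VS.
  by move=> SS; apply/subvP => v /vspace_bigcapP; apply.
split=> [d0 min_d0 [S [SS dimS dim_lt]]|C [CE SC]]; last first.
  have GE G : is_GCS Y X G -> G = C.
    move=> [SG [_ minG]]; apply/esym/eqP.
    by rewrite eqEdim CE kernel_sub// -CE minG.
  split=> //; exists C; split=> [|G /GE//]; split=> //.
  split; first by exists C.
  by move=> S' SS'; apply: dimvS; rewrite CE kernel_sub.
have GS : is_GCS Y X S by split; rewrite // dimS.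
exists S; split=> // G [SG [_ minG]].
have dimG : \dim G = d0.
  by apply/eqP; rewrite eqn_leq -{1}dimS minG// min_d0.2.
have sum_proper : (S + G)%VS != fullv.
  apply/eqP => SGT; have := dimv_sum_cap S G.
  rewrite SGT dimvf dim_matrix dimS dimG => dimE.
  have /dimvS capK : (kernel_contour_subspace Y X <= S :&: G)%VS.
    by rewrite subv_cap !kernel_sub.
  by move: dim_lt; rewrite ltr_pdivlMr// -natrD -natrM ltr_nat; lia.
have SGcap : is_SCS Y X (S :&: G)%VS.
  move: SS SG sum_proper; clear - p_gt1 X_density.
  case: p p_gt1 X X_density S G => // p' _ X X_density S G SS SG.
  exact: (is_SCS_cap X_density SS SG).
have min_cap := min_d0.2 _ SGcap.
have /eqP <- : (S :&: G)%VS == S by rewrite eqEdim capvSl dimS.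
by apply/eqP; rewrite eqEdim capvSr dimG.
Qed.
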